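(* Suppose that $\kappa$ is a singular cardinal of uncountable cofinality such that $\mathrm{cf}(\lambda)=\mathrm{cf}^{\mathrm{HOD}}(\lambda)$ for every ordinal $\lambda<\kappa$. Then $\mathrm{cf}(\kappa)=\mathrm{cf}^{\mathrm{HOD}}(\kappa)$.
   Context: A set is ordinal definable (OD) if it is of the form $\{z\in V_\beta\mid V_\beta\models\varphi(z,\alpha_0,\dots,\alpha_{n-1})\}$ for some formula $\varphi$ of the language of set theory and ordinals $\beta,\alpha_0,\dots,\alpha_{n-1}$. $\mathrm{HOD}$ is the class of all sets $A$ such that every element of the transitive closure of $\{A\}$ is OD; it is a transitive class model of $\mathrm{ZFC}$ containing all ordinals. $\mathrm{cf}^{\mathrm{HOD}}(\lambda)$ is the cofinality of $\lambda$ as computed in $\mathrm{HOD}$. *)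

(* Defs.v *)
From Stdlib Require Import List.

Set Implicit Arguments.
Unset Strict Implicit.
Unset Printing Implicit Defensive.

(** * Structures for the language of set theory *)

Structure estruct : Type := EStruct {
  carrier :> Type;
  elem : carrier -> carrier -> Prop
}.

Declare Scope eset_scope.
Open Scope eset_scope.
Notation "x ∈ y" := (elem x y) (at level 70, no associativity) : eset_scope.
Notation "x ∉ y" := (~ elem x y) (at level 70, no associativity) : eset_scope.

(** The class [P] of [U] as a structure of its own, with the membership
    relation of [U]; statements "in HOD" or "in V_beta" are statements about
    such a structure. *)
Definition sub (U : estruct) (P : U -> Prop) : estruct :=
  @EStruct {x : U | P x} (fun x y => proj1_sig x ∈ proj1_sig y).

Definition incl (U : estruct) (P : U -> Prop) (x : sub P) : U := proj1_sig x.

(** First-order formulas with de Bruijn indices: [fAll] binds index 0. *)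
Inductive form : Type :=
| fMem (i j : nat)
| fEq (i j : nat)
| fBot
| fImp (phi psi : form)
| fAll (phi : form).

Definition scons (T : Type) (x : T) (e : nat -> T) : nat -> T :=
  fun i => match i with O => x | S j => e j end.

Fixpoint sat (U : estruct) (phi : form) (e : nat -> U) : Prop :=
  match phi with
  | fMem i j => e i ∈ e j
  | fEq i j => e i = e j
  | fBot => False
  | fImp phi psi => sat phi e -> sat psi e
  | fAll phi => forall x : U, sat phi (scons x e)
  end.

(** * Basic notions, interpreted in an arbitrary structure *)

Section Notions.
Context {U : estruct}.
Implicit Types a b d e f k l p s w x y z : U.

Definition subset x y := forall z, z ∈ x -> z ∈ y.
Definition is_empty e := forall z, z ∉ e.
Definition is_succ y x := forall z, z ∈ y <-> z ∈ x \/ z = x.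

Definition is_upair p x y := forall z, z ∈ p <-> z = x \/ z = y.
(** Kuratowski pairs. *)
Definition is_opair p x y :=
  exists a b, is_upair a x x /\ is_upair b x y /\ is_upair p a b.

Definition maps f x y := exists p, is_opair p x y /\ p ∈ f.

Definition is_fun f a b :=
  (forall p, p ∈ f -> exists x y, x ∈ a /\ y ∈ b /\ is_opair p x y) /\
  (forall x, x ∈ a -> exists! y, maps f x y).

Definition is_bij f a b :=
  is_fun f a b /\
  (forall x x' y, maps f x y -> maps f x' y -> x = x') /\
  (forall y, y ∈ b -> exists x, maps f x y).

Definition transitive_set x := forall y, y ∈ x -> subset y x.

(** Transitive and well-ordered by membership. *)
Definition is_ordinal x :=
  transitive_set x /\
  (forall y z, y ∈ x -> z ∈ x -> y ∈ z \/ y = z \/ z ∈ y) /\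
  (forall s, subset s x -> (exists y, y ∈ s) ->
     exists y, y ∈ s /\ forall z, z ∈ s -> z ∉ y).

Definition ord_le a b := a ∈ b \/ a = b.

Definition is_limit a :=
  is_ordinal a /\ (exists x, x ∈ a) /\
  (forall x, x ∈ a -> exists y, y ∈ a /\ x ∈ y).

Definition is_omega w := is_limit w /\ forall a, a ∈ w -> ~ is_limit a.

Definition is_cardinal k :=
  is_ordinal k /\ forall a, a ∈ k -> ~ exists f, is_bij f a k.

Definition is_infinite_cardinal k :=
  is_cardinal k /\ exists w, is_omega w /\ ord_le w k.

Definition is_cofinal_map f d l :=
  is_fun f d l /\
  forall x, x ∈ l -> exists i y, maps f i y /\ ord_le x y.

(** [d] is the cofinality of the ordinal [l]; by this definition
    cf(0) = 0 and cf(a + 1) = 1. *)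
Definition is_cf l d :=
  is_ordinal d /\ (exists f, is_cofinal_map f d l) /\
  forall d', is_ordinal d' -> (exists f, is_cofinal_map f d' l) -> ord_le d d'.

Definition is_singular_cardinal k :=
  is_infinite_cardinal k /\ exists d, is_cf k d /\ d ∈ k.

(** Cofinalities are cardinals, so that "uncountable" is "greater than omega". *)
Definition has_uncountable_cf k :=
  exists d w, is_cf k d /\ is_omega w /\ w ∈ d.

(** [x] is V_b, where V_c is the union of the power sets of the V_d, d < c,
    and [h] is the sequence of the V_c for c <= b. *)
Definition is_rank_level b x :=
  exists h,
    (forall c y y', maps h c y -> maps h c y' -> y = y') /\
    (forall c, ord_le c b -> exists y, maps h c y /\
       forall z, z ∈ y <-> exists d v, d ∈ c /\ maps h d v /\ subset z v) /\
    maps h b x.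

(** Membership in the transitive closure of the class [S]. *)
Definition in_trcl (S : U -> Prop) x :=
  forall t, transitive_set t -> (forall y, S y -> y ∈ t) -> x ∈ t.

End Notions.

(** * Zermelo-Fraenkel set theory with choice, with first-order schemes *)

Record ZFC (U : estruct) : Prop := {
  zfc_extensionality : forall x y : U, (forall z, z ∈ x <-> z ∈ y) -> x = y;
  zfc_foundation : forall x : U, (exists y, y ∈ x) ->
    exists y, y ∈ x /\ forall z, z ∈ x -> z ∉ y;
  zfc_pairing : forall x y : U, exists p, is_upair p x y;
  zfc_union : forall x : U, exists u, forall z,
    z ∈ u <-> exists y, y ∈ x /\ z ∈ y;
  zfc_power : forall x : U, exists p, forall z, z ∈ p <-> subset z x;
  zfc_infinity : exists w : U,
    (exists e, is_empty e /\ e ∈ w) /\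
    (forall x, x ∈ w -> exists y, is_succ y x /\ y ∈ w);
  zfc_separation : forall (phi : form) (e : nat -> U) (x : U), exists s,
    forall z, z ∈ s <-> z ∈ x /\ sat phi (scons z e);
  zfc_replacement : forall (phi : form) (e : nat -> U) (a : U),
    (forall x, x ∈ a -> exists! y, sat phi (scons x (scons y e))) ->
    exists r, forall y,
      y ∈ r <-> exists x, x ∈ a /\ sat phi (scons x (scons y e));
  zfc_choice : forall x : U,
    (forall y, y ∈ x -> exists z, z ∈ y) ->
    (forall y y', y ∈ x -> y' ∈ x -> (exists z, z ∈ y /\ z ∈ y') -> y = y') ->
    exists c, forall y, y ∈ x -> exists! z, z ∈ y /\ z ∈ c
}.

(** * Ordinal definability *)

Section OrdinalDefinability.
Context {V : estruct}.

(** [X] is V_b, and [params] are ordinals in V_b. Index 0 of [phi] stands for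
    the element [z], index [i + 1] for the [i]-th parameter; an index beyond
    the parameters also stands for [z], so [phi] has no other free variables.
    Formulas are those of the metatheory even if the omega of [V] is
    nonstandard; this does not change the class OD, since a nonstandard formula
    can be traded for its code, an ordinal parameter, by reflecting the
    satisfaction formula. *)
Definition OD (A : V) : Prop :=
  exists (b X : V) (phi : form) (params : list (sub (fun x : V => x ∈ X))),
    is_ordinal b /\ is_rank_level b X /\
    (forall a, In a params -> is_ordinal (incl a)) /\
    (forall y : V, y ∈ A <->
       exists z : sub (fun x : V => x ∈ X),
         incl z = y /\ sat phi (fun i => nth i (z :: params) z)).

Definition HOD (A : V) : Prop :=
  forall x : V, in_trcl (fun y => y = A) x -> OD x.

(** [d] is the cofinality of [l] as computed in the class [M]. *)
Definition is_cf_in (M : V -> Prop) (l d : V) : Prop :=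
  exists l' d' : sub M, incl l' = l /\ incl d' = d /\ is_cf l' d'.

(** cf(l) = cf^HOD(l). *)
Definition cf_eq_cfHOD (l : V) : Prop :=
  exists d : V, is_cf l d /\ is_cf_in HOD l d.

End OrdinalDefinability.

(* Main.v *)
(** Let delta = cf(kappa), so omega < delta < kappa. By hypothesis every
    a < kappa of countable cofinality has a cofinal map in HOD from an ordinal at
    most omega. HOD has a definable well-ordering, so there are such maps
    (f_n(a))_n, uniformly definable from ordinals. Consider, for n < omega, the
    increasing sequence of the sets A_b = {a | f_n(a) < b}, b < kappa, modulo the
    nonstationary ideal on kappa. The set D of the b at which it grows is ordinal
    definable, and has size at most delta because it injects into a closed
    unbounded set of order type delta. If D is unbounded for some n, then its
    order type is some gamma < kappa, its increasing enumeration is in HOD, and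
    cf(gamma) = cf^HOD(gamma) transfers to kappa. Otherwise there is a single
    g < kappa with f_n(a) < g for almost all a, for every n; since the ideal is
    countably complete, almost every a of countable cofinality has a supremum of
    the f_n(a) at most g, which is absurd for a > g.

    The well-ordering is replaced by an enumeration, indexed by ordinals and
    definable by a single formula, of a family of sets containing all those
    defined over some V_b from ordinals by a formula of the metatheory; it is
    closed under the steps of the definition of truth, so this follows by
    induction on the formula. *)

From Stdlib Require Import List Arith Lia Classical ClassicalEpsilon.
Require Import Defs.

(** * Definability *)

(** Separation and replacement are schemes over formulas, and ordinal definability refers to
    formulas too. One semantic predicate [dfn Q] serves both: with all sets as constants it supplies
    instances of the schemes, and with ordinals as constants it yields OD sets by reflection. Hence
    every class function below comes with a proof that it is definable.

    D is ordinal definable although stationarity is taken in V: quantifying over all subsets of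
    kappa needs no parameter besides kappa. The injection that bounds its size need not be in HOD;
    only the resulting bound on its order type is used. Singularity enters here: delta < kappa puts
    that order type below kappa, within reach of the hypothesis.

    Uncountable cofinality enters twice: countably many bounds g have a common one below kappa, and
    omega many closing steps stay below kappa, which produces points of countable cofinality.
    Witnesses for nonstationarity are needed for delta many bounds b, too many to meet all at once;
    they are met diagonally, at x only those with b < x. *)

Fixpoint ren (r : nat -> nat) (phi : form) : form :=
  match phi with
  | fMem i j => fMem (r i) (r j)
  | fEq i j => fEq (r i) (r j)
  | fBot => fBot
  | fImp a b => fImp (ren r a) (ren r b)
  | fAll a => fAll (ren (fun i => match i with O => O | S j => S (r j) end) a)
  end.

Fixpoint fv_bound (phi : form) : nat :=
  match phi with
  | fMem i j | fEq i j => S (max i j)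
  | fBot => 0
  | fImp a b => max (fv_bound a) (fv_bound b)
  | fAll a => pred (fv_bound a)
  end.

Lemma sat_agree (U : estruct) (phi : form) : forall e e' : nat -> U,
  (forall i, i < fv_bound phi -> e i = e' i) -> sat phi e <-> sat phi e'.
Proof.
  induction phi as [i j|i j| |a IHa b IHb|a IHa]; simpl; intros e e' H.
  - rewrite (H i), (H j) by lia; tauto.
  - rewrite (H i), (H j) by lia; tauto.
  - tauto.
  - rewrite (IHa e e'), (IHb e e'); [tauto| |]; intros; apply H; lia.
  - assert (E : forall x, sat a (scons x e) <-> sat a (scons x e')).
    { intro x; apply IHa; intros [|i] Hi; simpl; [reflexivity|apply H; lia]. }
    split; intros G x; apply E, G.
Qed.

Lemma sat_ext (U : estruct) (phi : form) (e e' : nat -> U) :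
  (forall i, e i = e' i) -> sat phi e <-> sat phi e'.
Proof. intro H; apply sat_agree; auto. Qed.

Lemma sat_ren (U : estruct) (phi : form) : forall r (e : nat -> U),
  sat (ren r phi) e <-> sat phi (fun i => e (r i)).
Proof.
  induction phi as [i j|i j| |a IHa b IHb|a IHa]; simpl; intros r e; try tauto.
  - rewrite IHa, IHb; tauto.
  - split; intros G x; specialize (G x);
      [rewrite IHa in G|rewrite IHa];
      (eapply sat_ext; [|exact G]); intros [|i]; reflexivity.
Qed.

(** A nonempty class of admissible constants. *)
Record pclass (V : Type) := PClass { pc :> V -> Prop; pc_inh : exists c, pc c }.

(** Definability by a formula with constants in [Q], which are listed by [ps]:
    the variables from [n] on stand for the constants. *)
Definition dfn {V : estruct} (Q : pclass V) (P : (nat -> V) -> Prop) : Prop :=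
  exists phi n ps, (forall i, Q (ps i)) /\
    forall e, P e <-> sat phi (fun i => if i <? n then e i else ps (i - n)).

(** The language has no function symbols, so a term counts as definable through its graph, and it is
    substituted by quantifying over its value ([dfn_app1]). *)
Definition dtm {V : estruct} (Q : pclass V) (t : (nat -> V) -> V) : Prop :=
  dfn Q (fun e => e 0 = t (fun i => e (S i))).

Ltac ltb := repeat match goal with
  | |- context [?a <? ?b] => destruct (Nat.ltb_spec a b); try lia
  end.

Section Dfn.
Context {V : estruct} {Q : pclass V}.
Implicit Types P A : (nat -> V) -> Prop.

Lemma dfn_ext P P' : (forall e, P e <-> P' e) -> dfn Q P -> dfn Q P'.
Proof.
  intros H (phi & n & ps & Hp & E); exists phi, n, ps; split; auto.
  intro e; rewrite <- H; auto.
Qed.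

Lemma dfn_ren (r : nat -> nat) P : dfn Q P -> dfn Q (fun e => P (fun i => e (r i))).
Proof.
  intros (phi & n & ps & Hp & E).
  assert (exists N, forall i, i < n -> r i < N) as [N HN].
  { clear; induction n as [|n [N HN]]; [exists 0; lia|exists (max N (S (r n)))].
    intros i Hi; destruct (Nat.eq_dec i n) as [->|]; [lia|].
    specialize (HN i); lia. }
  (* The constants move above N, a bound on the renamed variables, so that no variable is mistaken
     for a constant. *)
  exists (ren (fun i => if i <? n then r i else N + (i - n)) phi), N, ps.
  split; auto; intro e; rewrite E, sat_ren; apply sat_ext; intro i; cbv beta.
  destruct (Nat.ltb_spec i n) as [Hi|Hi].
  - specialize (HN i Hi); ltb; reflexivity.
  - ltb; f_equal; lia.
Qed.

Lemma dfn_imp A B : dfn Q A -> dfn Q B -> dfn Q (fun e => A e -> B e).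
Proof.
  intros (f1 & n1 & p1 & H1 & E1) (f2 & n2 & p2 & H2 & E2).
  (* The two sequences of constants are interleaved above the variables of both formulas: [p1] at
     even positions, [p2] at odd ones. *)
  exists (fImp (ren (fun i => if i <? n1 then i else n1 + n2 + 2 * (i - n1)) f1)
            (ren (fun i => if i <? n2 then i else n1 + n2 + (2 * (i - n2) + 1)) f2)),
    (n1 + n2), (fun i => if Nat.even i then p1 (Nat.div2 i) else p2 (Nat.div2 i)).
  split; [intro i; destruct (Nat.even i); auto|].
  intro e; simpl; rewrite !sat_ren, E1, E2.
  enough (forall a b c d : Prop, (a <-> c) -> (b <-> d) -> (a -> b) <-> (c -> d)) as T.
  2: tauto.
  apply T; apply sat_ext; intro i; cbv beta.
  - destruct (Nat.ltb_spec i n1); ltb; [reflexivity|].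
    replace (_ + _ - _) with (2 * (i - n1)) by lia.
    rewrite Nat.even_mul, Nat.div2_double; reflexivity.
  - destruct (Nat.ltb_spec i n2); ltb; [reflexivity|].
    replace (_ + _ - _) with (2 * (i - n2) + 1) by lia.
    rewrite Nat.even_add, Nat.even_mul, Nat.add_1_r; simpl Nat.even.
    rewrite Nat.div2_succ_double; reflexivity.
Qed.

Lemma dfn_false : dfn Q (fun _ => False).
Proof.
  destruct (pc_inh V Q) as [c Hc]; exists fBot, 0, (fun _ => c); split; auto.
  intro; simpl; tauto.
Qed.

Lemma dfn_not A : dfn Q A -> dfn Q (fun e => ~ A e).
Proof. intro H; apply dfn_imp; [exact H|apply dfn_false]. Qed.

Lemma dfn_and A B : dfn Q A -> dfn Q B -> dfn Q (fun e => A e /\ B e).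
Proof.
  intros HA HB; apply dfn_ext with (fun e => ~ (A e -> ~ B e)); [intro; tauto|].
  apply dfn_not, dfn_imp; [|apply dfn_not]; auto.
Qed.

Lemma dfn_or A B : dfn Q A -> dfn Q B -> dfn Q (fun e => A e \/ B e).
Proof.
  intros HA HB; apply dfn_ext with (fun e => ~ A e -> B e); [intro; tauto|].
  apply dfn_imp; [apply dfn_not|]; auto.
Qed.

Lemma dfn_iff A B : dfn Q A -> dfn Q B -> dfn Q (fun e => A e <-> B e).
Proof. intros HA HB; apply dfn_and; apply dfn_imp; auto. Qed.

Lemma dfn_all (B : V -> (nat -> V) -> Prop) :
  dfn Q (fun e => B (e 0) (fun i => e (S i))) -> dfn Q (fun e => forall x, B x e).
Proof.
  intros (phi & n & ps & Hp & E).
  (* The number n of variables is kept although index 0 is now bound, so under the quantifier the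
     constants sit one place higher. *)
  exists (fAll (ren (fun i => if i <? n then i else S i) phi)), n, ps; split; auto.
  intro e; simpl.
  assert (G : forall x, B x e <-> sat (ren (fun i => if i <? n then i else S i) phi)
      (scons x (fun i => if i <? n then e i else ps (i - n)))).
  { intro x; rewrite sat_ren.
    etransitivity; [exact (E (scons x e))|apply sat_ext]; intro i; simpl.
    destruct (Nat.ltb_spec i n).
    - destruct i; simpl; [reflexivity|ltb; reflexivity].
    - simpl; ltb; reflexivity. }
  split; intros H x; apply G, H.
Qed.

Lemma dfn_ex (B : V -> (nat -> V) -> Prop) :
  dfn Q (fun e => B (e 0) (fun i => e (S i))) -> dfn Q (fun e => exists x, B x e).
Proof.
  intro H; apply dfn_ext with (fun e => ~ forall x, ~ B x e).
  - intro e; split; [|firstorder].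
    intro K; apply NNPP; intro L; apply K; intros x Hx; apply L; eauto.
  - apply dfn_not, dfn_all, dfn_not; exact H.
Qed.

Lemma dtm_var k : dtm Q (fun e => e k).
Proof.
  destruct (pc_inh V Q) as [c Hc]; exists (fEq 0 (S k)), (S (S k)), (fun _ => c).
  split; auto; intro e; simpl; ltb; tauto.
Qed.

Lemma dtm_const c : Q c -> dtm Q (fun _ => c).
Proof.
  intro Hc; exists (fEq 0 1), 1, (fun _ => c); split; auto; intro e; simpl; tauto.
Qed.

Lemma dfn_app1 (B : V -> (nat -> V) -> Prop) t :
  dfn Q (fun e => B (e 0) (fun i => e (S i))) -> dtm Q t -> dfn Q (fun e => B (t e) e).
Proof.
  intros HB Ht; apply dfn_ext with (fun e => exists x, x = t e /\ B x e).
  - intro e; split; [intros (x & -> & H); exact H|eauto].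
  - apply dfn_ex, dfn_and; auto.
Qed.

(** Reduces arbitrary arguments to variables: a notion is unfolded once, on [e 0] and [e 1], and can
    then be applied to any definable terms. *)
Lemma dfn_app2 (P : V -> V -> Prop) :
  dfn Q (fun e => P (e 0) (e 1)) ->
  forall t u, dtm Q t -> dtm Q u -> dfn Q (fun e => P (t e) (u e)).
Proof.
  intros H t u Ht Hu; apply (dfn_app1 (fun x e => P x (u e))); [|exact Ht].
  apply (dfn_app1 (fun y e => P (e 0) y) (fun e => u (fun i => e (S i)))).
  - exact (dfn_ren (fun i => match i with 0 => 1 | _ => 0 end) _ H).
  - exact (dfn_ren (fun i => match i with 0 => 0 | S i => S (S i) end) _ Hu).
Qed.

Lemma dfn_app3 (P : V -> V -> V -> Prop) :
  dfn Q (fun e => P (e 0) (e 1) (e 2)) ->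
  forall t u v, dtm Q t -> dtm Q u -> dtm Q v -> dfn Q (fun e => P (t e) (u e) (v e)).
Proof.
  intros H t u v Ht Hu Hv; apply (dfn_app1 (fun x e => P x (u e) (v e))); [|exact Ht].
  apply (dfn_app1 (fun y e => P (e 0) y (v (fun i => e (S i))))
    (fun e => u (fun i => e (S i)))).
  - apply (dfn_app1 (fun z e => P (e 1) (e 0) z)
      (fun e => v (fun i => e (S (S i))))).
    + exact (dfn_ren (fun i => match i with 0 => 2 | 1 => 1 | _ => 0 end) _ H).
    + exact (dfn_ren (fun i => match i with 0 => 0 | S i => S (S (S i)) end) _ Hv).
  - exact (dfn_ren (fun i => match i with 0 => 0 | S i => S (S i) end) _ Hu).
Qed.

Lemma dfn_app4 (P : V -> V -> V -> V -> Prop) :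
  dfn Q (fun e => P (e 0) (e 1) (e 2) (e 3)) ->
  forall t u v w, dtm Q t -> dtm Q u -> dtm Q v -> dtm Q w ->
  dfn Q (fun e => P (t e) (u e) (v e) (w e)).
Proof.
  intros H t u v w Ht Hu Hv Hw.
  apply (dfn_app1 (fun x e => P x (u e) (v e) (w e))); [|exact Ht].
  apply (dfn_app1 (fun y e => P (e 0) y (v (fun i => e (S i))) (w (fun i => e (S i))))
    (fun e => u (fun i => e (S i)))).
  - apply (dfn_app1 (fun z e => P (e 1) (e 0) z (w (fun i => e (S (S i)))))
      (fun e => v (fun i => e (S (S i))))).
    + apply (dfn_app1 (fun z e => P (e 2) (e 1) (e 0) z)
        (fun e => w (fun i => e (S (S (S i)))))).
      * exact (dfn_ren (fun i => match i with 0 => 3 | 1 => 2 | 2 => 1 | _ => 0 end) _ H).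
      * exact (dfn_ren (fun i => match i with 0 => 0 | S i => S (S (S (S i))) end) _ Hw).
    + exact (dfn_ren (fun i => match i with 0 => 0 | S i => S (S (S i)) end) _ Hv).
  - exact (dfn_ren (fun i => match i with 0 => 0 | S i => S (S i) end) _ Hu).
Qed.

Lemma dfn_eq t u : dtm Q t -> dtm Q u -> dfn Q (fun e => t e = u e).
Proof. apply dfn_app2, dtm_var. Qed.

Lemma dfn_mem t u : dtm Q t -> dtm Q u -> dfn Q (fun e => t e ∈ u e).
Proof.
  apply dfn_app2; destruct (pc_inh V Q) as [c Hc].
  exists (fMem 0 1), 2, (fun _ => c); split; auto; intro; simpl; tauto.
Qed.

Lemma dtm_app1 (F : V -> V) :
  dtm Q (fun e => F (e 0)) -> forall t, dtm Q t -> dtm Q (fun e => F (t e)).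
Proof.
  intros H t Ht; unfold dtm.
  apply (dfn_app2 (fun y x => y = F x)); [exact H|apply dtm_var|].
  exact (dfn_ren (fun i => match i with 0 => 0 | S i => S (S i) end) _ Ht).
Qed.

Lemma dtm_app2 (F : V -> V -> V) :
  dtm Q (fun e => F (e 0) (e 1)) ->
  forall t u, dtm Q t -> dtm Q u -> dtm Q (fun e => F (t e) (u e)).
Proof.
  intros H t u Ht Hu; unfold dtm.
  apply (dfn_app3 (fun y x z => y = F x z)); [exact H|apply dtm_var| |].
  - exact (dfn_ren (fun i => match i with 0 => 0 | S i => S (S i) end) _ Ht).
  - exact (dfn_ren (fun i => match i with 0 => 0 | S i => S (S i) end) _ Hu).
Qed.

(** The induction is on a formula of the metatheory, so each [phi] gets its own defining formula;
    this is no truth definition for V. *)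
Lemma dfn_sat (phi : form) : forall t : nat -> (nat -> V) -> V,
  (forall i, dtm Q (t i)) -> dfn Q (fun e => sat phi (fun i => t i e)).
Proof.
  induction phi as [i j|i j| |a IHa b IHb|a IHa]; simpl; intros t Ht.
  - apply dfn_mem; auto.
  - apply dfn_eq; auto.
  - apply dfn_false.
  - apply dfn_imp; auto.
  - apply dfn_all.
    apply dfn_ext with (fun e => sat a (fun i =>
      (match i with 0 => fun e => e 0 | S i => fun e => t i (fun j => e (S j)) end) e)).
    + intro e; apply sat_ext; intros [|i]; reflexivity.
    + apply IHa; intros [|i]; [apply dtm_var|].
      exact (dfn_ren (fun i => match i with 0 => 0 | S i => S (S i) end) _ (Ht i)).
Qed.

End Dfn.

Create HintDb dfn discriminated.
#[export] Hint Constants Opaque : dfn.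
#[export] Hint Extern 0 (dfn _ (fun _ => _ /\ _)) => apply dfn_and : dfn.
#[export] Hint Extern 0 (dfn _ (fun _ => _ \/ _)) => apply dfn_or : dfn.
#[export] Hint Extern 0 (dfn _ (fun _ => _ <-> _)) => apply dfn_iff : dfn.
#[export] Hint Extern 0 (dfn _ (fun _ => ~ _)) => apply dfn_not : dfn.
#[export] Hint Extern 0 (dfn _ (fun _ => False)) => apply dfn_false : dfn.
#[export] Hint Extern 0 (dfn _ (fun _ => _ = _)) => apply dfn_eq : dfn.
#[export] Hint Extern 0 (dfn _ (fun _ => elem _ _)) => apply dfn_mem : dfn.
#[export] Hint Extern 0 (dfn _ (fun _ => exists _, _)) =>
  apply dfn_ex; cbv beta : dfn.
#[export] Hint Extern 0 (dfn _ (fun _ => forall _, _)) =>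
  first [apply dfn_imp | apply dfn_all; cbv beta] : dfn.
#[export] Hint Extern 0 (dtm _ (fun _ => _)) =>
  lazymatch goal with |- dtm _ (fun e => e ?k) => exact (dtm_var k) end : dfn.
#[export] Hint Extern 2 (dtm _ (fun _ => _)) =>
  lazymatch goal with |- dtm _ (fun _ => ?c) => apply (dtm_const c) end : dfn.


Ltac dfn_tac := cbv beta; auto 60 with dfn nocore.

(** * Sets and ordinals *)

Ltac splits := lazymatch goal with |- _ /\ _ => split; [|splits] | _ => idtac end.

Existing Class ZFC.

Section Sets.
Context {V : estruct} {zfcV : ZFC V}.
Implicit Types x y z a b c s p f : V.

Lemma ext x y : (forall z, z ∈ x <-> z ∈ y) -> x = y.
Proof. apply zfc_extensionality; assumption. Qed.

Lemma ex_empty : exists e : V, is_empty e.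
Proof. destruct (zfc_infinity zfcV) as (w & (e & He & _) & _); eauto. Qed.

Lemma iota_ex (P : V -> Prop) : exists x,
  (P x /\ forall y, P y -> y = x) \/
  (~ (exists x, P x /\ forall y, P y -> y = x) /\ is_empty x).
Proof.
  destruct (classic (exists x, P x /\ forall y, P y -> y = x)) as [[x H]|H]; eauto.
  destruct ex_empty as [e He]; eauto.
Qed.

(** The unique [x] with [P x]; the empty set if there is no such or no unique [x]. *)
Definition iota (P : V -> Prop) : V :=
  proj1_sig (constructive_indefinite_description _ (iota_ex P)).

(** A first-order description of the value, default included; it is what makes terms built with
    [iota] definable. *)
Lemma iota_graph P x : x = iota P <->
  (P x /\ forall y, P y -> y = x) \/
  (~ (exists x, P x /\ forall y, P y -> y = x) /\ forall z, z ∉ x).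
Proof.
  unfold iota; destruct (constructive_indefinite_description _ (iota_ex P)) as [y Hy]; simpl.
  split; [intros ->; exact Hy|].
  destruct Hy as [[Hy Uy]|[Ny Ey]]; intros [[Hx Ux]|[Nx Ex]]; auto.
  - destruct Nx; eauto.
  - destruct Ny; eauto.
  - apply ext; intro z; split; intro H; [destruct (Ex _ H)|destruct (Ey _ H)].
Qed.

Lemma iota_eq (P : V -> Prop) x : P x -> (forall y, P y -> y = x) -> iota P = x.
Proof. intros H U; symmetry; apply iota_graph; auto. Qed.

Lemma iota_ext (P P' : V -> Prop) : (forall x, P x <-> P' x) -> iota P = iota P'.
Proof.
  intro H; apply iota_graph.
  destruct (proj1 (iota_graph P (iota P)) eq_refl) as [[H1 H2]|[H1 H2]]; [left|right];
    (split; [|try exact H2]).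
  - apply H, H1.
  - intros y Hy; apply H2, H, Hy.
  - intros (x & Hx & U); apply H1; exists x; split; [apply H, Hx|].
    intros y Hy; apply U, H, Hy.
Qed.

Lemma dtm_iota Q (P : V -> (nat -> V) -> Prop) :
  dfn Q (fun e => P (e 0) (fun i => e (S i))) -> dtm Q (fun e => iota (fun x => P x e)).
Proof.
  intro H; unfold dtm.
  assert (H2 : dfn Q (fun e => P (e 0) (fun i => e (S (S i))))).
  { exact (dfn_ren (fun i => match i with 0 => 0 | S i => S (S i) end) _ H). }
  assert (H3 : dfn Q (fun e => P (e 0) (fun i => e (S (S (S i)))))).
  { exact (dfn_ren (fun i => match i with 0 => 0 | S i => S (S (S i)) end) _ H). }
  eapply dfn_ext; [intro e; symmetry; apply iota_graph|]; cbv beta.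
  dfn_tac.
Qed.

Definition set_exists (P : V -> Prop) := exists s, forall z, z ∈ s <-> P z.
(** Total by the default of [iota]: for a proper class the value is the empty set. *)
Definition setof (P : V -> Prop) : V := iota (fun s => forall z, z ∈ s <-> P z).

Lemma in_setof P : set_exists P -> forall z, z ∈ setof P <-> P z.
Proof.
  intros [s Hs]; unfold setof; rewrite (iota_eq _ s); auto.
  intros y Hy; apply ext; intro z; rewrite Hy, Hs; tauto.
Qed.

Lemma dtm_setof Q (P : V -> (nat -> V) -> Prop) :
  dfn Q (fun e => P (e 0) (fun i => e (S i))) -> dtm Q (fun e => setof (fun x => P x e)).
Proof.
  intro H; apply (dtm_iota Q (fun s e => forall z, z ∈ s <-> P z e)).
  assert (H2 : dfn Q (fun e => P (e 0) (fun i => e (S (S i))))).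
  { exact (dfn_ren (fun i => match i with 0 => 0 | S i => S (S i) end) _ H). }
  dfn_tac.
Qed.

Definition empty : V := setof (fun _ => False).
Lemma in_empty z : z ∉ empty.
Proof.
  unfold empty; rewrite in_setof; auto.
  destruct ex_empty as [e He]; exists e; intro y; split; [apply He|tauto].
Qed.

(** Definability with arbitrary parameters, as the axiom schemes allow. *)
Definition Any : pclass V := PClass V (fun _ => True) (ex_intro _ empty I).

Lemma Any_intro c : Any c.
Proof. exact I. Qed.

End Sets.

#[export] Hint Resolve Any_intro : dfn.
#[export] Hint Extern 0 (dtm _ (fun _ => iota _)) => apply dtm_iota; cbv beta : dfn.
#[export] Hint Extern 0 (dtm _ (fun _ => setof _)) => apply dtm_setof; cbv beta : dfn.

Notation dfn_any P := (dfn Any (fun e => P (e 0))) (only parsing).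
Notation dtm_any t := (dtm Any (fun e => t (e 0))) (only parsing).

Section Sets2.
Context {V : estruct} {zfcV : ZFC V}.
Implicit Types x y z a b c s p f : V.

Lemma sep_exists x (P : V -> Prop) : dfn_any P -> set_exists (fun z => z ∈ x /\ P z).
Proof.
  intros (phi & n & ps & _ & E).
  (* [P] sees only [e 0], so all variables may be identified with index 0; the constants follow from
     index 1 on. *)
  destruct (zfc_separation zfcV
    (ren (fun i => if i <? n then 0 else S (i - n)) phi) ps x) as [s Hs].
  exists s; intro z; rewrite Hs, sat_ren.
  rewrite (E (fun _ => z)).
  enough (forall A B B' : Prop, (B <-> B') -> (A /\ B <-> A /\ B')) as T by
    (apply T, sat_ext; intro i; ltb; reflexivity).
  tauto.
Qed.

Lemma set_exists_bound x (P : V -> Prop) :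
  dfn_any P -> (forall z, P z -> z ∈ x) -> set_exists P.
Proof.
  intros H B; destruct (sep_exists x P H) as [s Hs]; exists s; intro z.
  rewrite Hs; split; [tauto|auto].
Qed.

Lemma in_sep x (P : V -> Prop) : dfn_any P ->
  forall z, z ∈ setof (fun z => z ∈ x /\ P z) <-> z ∈ x /\ P z.
Proof. intro H; apply in_setof, sep_exists, H. Qed.

Lemma image_exists a (t : V -> V) : dtm_any t ->
  set_exists (fun y => exists x, x ∈ a /\ y = t x).
Proof.
  intros Ht.
  assert (H : dfn Any (fun e => e 1 = t (e 0))) by dfn_tac.
  destruct H as (phi & n & ps & _ & E).
  assert (G : forall x y, sat (ren (fun i => if i <? n then (match i with 0 => 0 | _ => 1 end)
      else S (S (i - n))) phi) (scons x (scons y ps)) <-> y = t x).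
  { intros x y; rewrite sat_ren; rewrite (E (scons x (fun _ => y))).
    apply sat_ext; intros [|i]; ltb; reflexivity. }
  destruct (zfc_replacement zfcV (phi := ren (fun i => if i <? n then
      (match i with 0 => 0 | _ => 1 end) else S (S (i - n))) phi) (e := ps) (a := a))
    as [r Hr].
  - intros x _; exists (t x); split; [apply G; reflexivity|].
    intros y Hy; apply G in Hy; auto.
  - exists r; intro y; rewrite Hr; split; intros (x & Hx & Hy); exists x; split; auto;
      apply G; auto.
Qed.

Definition image (t : V -> V) a := setof (fun y => exists x, x ∈ a /\ y = t x).
Lemma in_image a (t : V -> V) : dtm_any t ->
  forall y, y ∈ image t a <-> exists x, x ∈ a /\ y = t x.
Proof. intro H; apply in_setof, image_exists, H. Qed.

Definition upair x y := setof (fun z => z = x \/ z = y).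
Lemma in_upair x y z : z ∈ upair x y <-> z = x \/ z = y.
Proof.
  unfold upair; rewrite in_setof; [tauto|];
    destruct (zfc_pairing zfcV x y) as [p Hp]; exists p; exact Hp.
Qed.

Definition bigcup x := setof (fun z => exists y, y ∈ x /\ z ∈ y).
Lemma in_bigcup x z : z ∈ bigcup x <-> exists y, y ∈ x /\ z ∈ y.
Proof.
  unfold bigcup; rewrite in_setof; [tauto|];
    destruct (zfc_union zfcV x) as [p Hp]; exists p; exact Hp.
Qed.

Definition power x := setof (fun z => subset z x).
Lemma in_power x z : z ∈ power x <-> subset z x.
Proof.
  unfold power; rewrite in_setof; [tauto|];
    destruct (zfc_power zfcV x) as [p Hp]; exists p; exact Hp.
Qed.

Definition cup x y := setof (fun z => z ∈ x \/ z ∈ y).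
Lemma in_cup x y z : z ∈ cup x y <-> z ∈ x \/ z ∈ y.
Proof.
  unfold cup; rewrite in_setof; [tauto|].
  exists (bigcup (upair x y)); intro w; rewrite in_bigcup; split.
  - intros (u & Hu & Hw); apply in_upair in Hu; destruct Hu as [-> | ->]; auto.
  - intros [H|H]; [exists x|exists y]; split; auto; apply in_upair; auto.
Qed.

Definition succ x := setof (fun z => z ∈ x \/ z = x).
Lemma in_succ x z : z ∈ succ x <-> z ∈ x \/ z = x.
Proof.
  unfold succ; rewrite in_setof; [tauto|].
  exists (cup x (upair x x)); intro w; rewrite in_cup, in_upair; tauto.
Qed.

Definition opair x y := upair (upair x x) (upair x y).

Lemma is_upair_iff p x y : is_upair p x y <-> p = upair x y.
Proof.
  split.
  - intro H; apply ext; intro z; rewrite in_upair; apply H.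
  - intros -> z; apply in_upair.
Qed.

Lemma is_opair_iff p x y : is_opair p x y <-> p = opair x y.
Proof.
  unfold is_opair; split.
  - intros (a & b & Ha & Hb & Hp); apply is_upair_iff in Ha, Hb, Hp; subst; reflexivity.
  - intros ->; exists (upair x x), (upair x y); rewrite !is_upair_iff; auto.
Qed.

Lemma maps_iff f x y : maps f x y <-> opair x y ∈ f.
Proof.
  unfold maps; split.
  - intros (p & Hp & H); apply is_opair_iff in Hp; subst; exact H.
  - intro H; exists (opair x y); rewrite is_opair_iff; auto.
Qed.

Lemma upair_eq x y z w : upair x y = upair z w -> (x = z /\ y = w) \/ (x = w /\ y = z).
Proof.
  intro H.
  assert (E : forall u, (u = x \/ u = y) <-> (u = z \/ u = w)).
  { intro u; rewrite <- !in_upair, H; tauto. }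
  destruct (proj1 (E x) (or_introl eq_refl)), (proj1 (E y) (or_intror eq_refl)),
    (proj2 (E z) (or_introl eq_refl)), (proj2 (E w) (or_intror eq_refl)); subst; auto.
Qed.

Lemma opair_inj x y z w : opair x y = opair z w -> x = z /\ y = w.
Proof.
  intro H; apply upair_eq in H; destruct H as [[H1 H2]|[H1 H2]];
    apply upair_eq in H1, H2; intuition congruence.
Qed.

Definition fst x := iota (fun y => exists z, x = opair y z).
Definition snd x := iota (fun z => exists y, x = opair y z).
Lemma fst_opair x y : fst (opair x y) = x.
Proof. apply iota_eq; [eauto|]; intros z (w & H); apply opair_inj in H; symmetry; tauto. Qed.
Lemma snd_opair x y : snd (opair x y) = y.
Proof. apply iota_eq; [eauto|]; intros z (w & H); apply opair_inj in H; symmetry; tauto. Qed.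

Definition app f x := iota (fun y => maps f x y).
Lemma app_eq f x y : maps f x y -> (forall z, maps f x z -> z = y) -> app f x = y.
Proof. intros; apply iota_eq; auto. Qed.

Definition graph (t : V -> V) a := setof (fun p => exists x, x ∈ a /\ p = opair x (t x)).

(** The empty set if no ordinal satisfies [P]. *)
Definition least (P : V -> Prop) :=
  iota (fun x => is_ordinal x /\ P x /\ forall y, y ∈ x -> ~ P y).

Lemma least_ext (P P' : V -> Prop) : (forall x, P x <-> P' x) -> least P = least P'.
Proof.
  intro H; apply iota_ext; intro x; rewrite H.
  split; intros (Ox & Px & Hx); splits; auto; intros y Hy Py; apply (Hx y Hy), H, Py.
Qed.

End Sets2.

(** * Definability of the basic set operations *)

Section DfnSets.
Context {V : estruct} {zfcV : ZFC V} {Q : pclass V}.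
Implicit Types t u v : (nat -> V) -> V.

Lemma dfn_subset t u : dtm Q t -> dtm Q u -> dfn Q (fun e => subset (t e) (u e)).
Proof. apply dfn_app2; unfold subset; dfn_tac. Qed.
Lemma dtm_empty : dtm Q (fun _ => empty).
Proof. unfold empty; dfn_tac. Qed.
Lemma dtm_upair t u : dtm Q t -> dtm Q u -> dtm Q (fun e => upair (t e) (u e)).
Proof. apply dtm_app2; unfold upair; dfn_tac. Qed.
Lemma dtm_bigcup t : dtm Q t -> dtm Q (fun e => bigcup (t e)).
Proof. apply dtm_app1; unfold bigcup; dfn_tac. Qed.
#[local] Hint Resolve dfn_subset dtm_upair : dfn.
Lemma dtm_succ t : dtm Q t -> dtm Q (fun e => succ (t e)).
Proof. apply dtm_app1; unfold succ; dfn_tac. Qed.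
Lemma dtm_opair t u : dtm Q t -> dtm Q u -> dtm Q (fun e => opair (t e) (u e)).
Proof. apply dtm_app2; unfold opair; dfn_tac. Qed.
#[local] Hint Resolve dtm_opair : dfn.
Lemma dtm_fst t : dtm Q t -> dtm Q (fun e => fst (t e)).
Proof. apply dtm_app1; unfold fst; dfn_tac. Qed.
Lemma dtm_snd t : dtm Q t -> dtm Q (fun e => snd (t e)).
Proof. apply dtm_app1; unfold snd; dfn_tac. Qed.
Lemma dfn_maps t u v : dtm Q t -> dtm Q u -> dtm Q v ->
  dfn Q (fun e => maps (t e) (u e) (v e)).
Proof.
  apply dfn_app3; eapply dfn_ext; [intro; symmetry; apply maps_iff|]; dfn_tac.
Qed.
#[local] Hint Resolve dfn_maps : dfn.
Lemma dtm_app t u : dtm Q t -> dtm Q u -> dtm Q (fun e => app (t e) (u e)).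
Proof. apply dtm_app2; unfold app; dfn_tac. Qed.
Lemma dfn_is_ordinal t : dtm Q t -> dfn Q (fun e => is_ordinal (t e)).
Proof.
  apply (dfn_app1 (fun x e => is_ordinal x)).
  unfold is_ordinal, transitive_set; dfn_tac.
Qed.
Lemma dfn_ord_le t u : dtm Q t -> dtm Q u -> dfn Q (fun e => ord_le (t e) (u e)).
Proof. apply dfn_app2; unfold ord_le; dfn_tac. Qed.
#[local] Hint Resolve dfn_is_ordinal dfn_ord_le : dfn.
Lemma dfn_is_opair t u v : dtm Q t -> dtm Q u -> dtm Q v ->
  dfn Q (fun e => is_opair (t e) (u e) (v e)).
Proof.
  apply dfn_app3; eapply dfn_ext; [intro; symmetry; apply is_opair_iff|]; dfn_tac.
Qed.
#[local] Hint Resolve dfn_is_opair : dfn.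
Lemma dfn_is_fun t u v : dtm Q t -> dtm Q u -> dtm Q v ->
  dfn Q (fun e => is_fun (t e) (u e) (v e)).
Proof. apply dfn_app3; unfold is_fun, unique; dfn_tac. Qed.
#[local] Hint Resolve dfn_is_fun : dfn.
Lemma dfn_is_cofinal_map t u v : dtm Q t -> dtm Q u -> dtm Q v ->
  dfn Q (fun e => is_cofinal_map (t e) (u e) (v e)).
Proof. apply dfn_app3; unfold is_cofinal_map; dfn_tac. Qed.

Lemma dtm_least (P : V -> (nat -> V) -> Prop) :
  dfn Q (fun e => P (e 0) (fun i => e (S i))) -> dtm Q (fun e => least (fun x => P x e)).
Proof.
  intro H; unfold least.
  assert (H2 : dfn Q (fun e => P (e 0) (fun i => e (S (S i))))).
  { exact (dfn_ren (fun i => match i with 0 => 0 | S i => S (S i) end) _ H). }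
  dfn_tac.
Qed.

Lemma dtm_image (F : V -> (nat -> V) -> V) t :
  dtm Q (fun e => F (e 0) (fun i => e (S i))) -> dtm Q t ->
  dtm Q (fun e => image (fun x => F x e) (t e)).
Proof.
  intros H Ht; unfold image; apply dtm_setof; cbv beta.
  apply dfn_ex; cbv beta; apply dfn_and.
  - apply dfn_mem; [dfn_tac|].
    exact (dfn_ren (fun i => match i with 0 => 0 | S i => S (S (S i)) end) _ Ht).
  - apply dfn_eq; [dfn_tac|].
    exact (dfn_ren (fun i => match i with 0 => 0 | 1 => 1 | S i => S (S i) end) _ H).
Qed.

Lemma dtm_graph (F : V -> (nat -> V) -> V) t :
  dtm Q (fun e => F (e 0) (fun i => e (S i))) -> dtm Q t ->
  dtm Q (fun e => graph (fun x => F x e) (t e)).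
Proof.
  intros H Ht; apply (dtm_image (fun x e => opair x (F x e))); [|exact Ht].
  dfn_tac.
Qed.
End DfnSets.

#[export] Hint Resolve dfn_subset dtm_empty dtm_upair dtm_bigcup 
  dtm_succ dtm_opair dtm_fst dtm_snd dfn_maps dtm_app dfn_is_ordinal dfn_ord_le
  dfn_is_opair dfn_is_fun dfn_is_cofinal_map : dfn.
#[export] Hint Extern 0 (dtm _ (fun _ => least _)) => apply dtm_least; cbv beta : dfn.
#[export] Hint Extern 0 (dtm _ (fun _ => image _ _)) => apply dtm_image; cbv beta : dfn.
#[export] Hint Extern 0 (dtm _ (fun _ => graph _ _)) => apply dtm_graph; cbv beta : dfn.

(** * Elementary theory of ordinals *)

Section Ordinals.
Context {V : estruct} {zfcV : ZFC V}.
Implicit Types x y z a b c s p f : V.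

Lemma foundation x : (exists y, y ∈ x) -> exists y, y ∈ x /\ forall z, z ∈ x -> z ∉ y.
Proof. apply zfc_foundation; assumption. Qed.

Lemma mem_irrefl x : x ∉ x.
Proof.
  intro H; destruct (foundation (upair x x)) as (y & Hy & Hm).
  { exists x; apply in_upair; auto. }
  apply in_upair in Hy; apply (Hm x); [apply in_upair; auto|].
  destruct Hy as [-> | ->]; exact H.
Qed.

Lemma mem_asym x y : x ∈ y -> y ∉ x.
Proof.
  intros H H'; destruct (foundation (upair x y)) as (z & Hz & Hm).
  { exists x; apply in_upair; auto. }
  apply in_upair in Hz; destruct Hz as [-> | ->].
  - apply (Hm y); [apply in_upair|]; auto.
  - apply (Hm x); [apply in_upair|]; auto.
Qed.

Lemma mem_no_3cycle x y z : x ∈ y -> y ∈ z -> z ∉ x.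
Proof.
  intros H1 H2 H3.
  destruct (foundation (cup (upair x y) (upair z z))) as (w & Hw & Hm).
  { exists x; apply in_cup; rewrite in_upair; auto. }
  rewrite in_cup, !in_upair in Hw.
  assert (Hm' : forall u, u = x \/ u = y \/ u = z -> u ∉ w).
  { intros u Hu; apply Hm; rewrite in_cup, !in_upair; tauto. }
  destruct Hw as [[-> | ->]|[-> | ->]].
  - apply (Hm' z); auto.
  - apply (Hm' x); auto.
  - apply (Hm' y); auto.
  - apply (Hm' y); auto.
Qed.

(** By foundation, the third clause of [is_ordinal] is automatic. *)
Lemma ordinal_intro x : transitive_set x ->
  (forall y z, y ∈ x -> z ∈ x -> y ∈ z \/ y = z \/ z ∈ y) -> is_ordinal x.
Proof.
  intros T L; repeat split; auto.
  intros s _ Hs; apply foundation; exact Hs.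
Qed.

Lemma ord_trans x y z : is_ordinal z -> x ∈ y -> y ∈ z -> x ∈ z.
Proof. intros [T _] H1 H2; exact (T y H2 x H1). Qed.

Lemma ord_elem x y : is_ordinal x -> y ∈ x -> is_ordinal y.
Proof.
  intros Hx Hy; pose proof Hx as (T & L & _); apply ordinal_intro.
  - intros z Hz w Hw.
    assert (z ∈ x) by exact (T y Hy z Hz); assert (w ∈ x) by (apply (T z); auto).
    destruct (L w y) as [H1|[H1|H1]]; auto.
    + subst; destruct (mem_asym y z); auto.
    + destruct (mem_no_3cycle w z y); auto.
  - intros u w Hu Hw; apply L; apply (T y); auto.
Qed.

(** If the difference of b and a is nonempty, its membership-minimal element is a itself. *)
Lemma ord_subset a b : is_ordinal a -> is_ordinal b -> subset a b -> a ∈ b \/ a = b.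
Proof.
  intros Ha Hb S; destruct (classic (a = b)) as [|N]; [auto|left].
  pose (d := setof (fun z => z ∈ b /\ z ∉ a)).
  assert (Hd : forall z, z ∈ d <-> z ∈ b /\ z ∉ a).
  { apply in_sep; dfn_tac. }
  destruct (foundation d) as (m & Hm & Hmin).
  - apply NNPP; intro E; apply N, ext; intro z; split; [apply S|].
    intro Hz; apply NNPP; intro Hz'; apply E; exists z; apply Hd; auto.
  - apply Hd in Hm as [Hmb Hma].
    replace a with m; [exact Hmb|]; apply ext; intro z; split; intro Hz.
    + apply NNPP; intro Hz'; apply (Hmin z); [apply Hd|]; auto.
      split; [eapply ord_trans; eauto|auto].
    + destruct (proj1 (proj2 Hb) z m (S z Hz) Hmb) as [H|[H|H]]; auto.
      * subst; tauto.
      * destruct Hma; eapply ord_trans; eauto.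
Qed.

(** The intersection of a and b is an ordinal; if it differed from both, it would belong to both and
    hence to itself. *)
Lemma ord_trichotomy a b : is_ordinal a -> is_ordinal b -> a ∈ b \/ a = b \/ b ∈ a.
Proof.
  intros Ha Hb; pose (i := setof (fun z => z ∈ a /\ z ∈ b)).
  assert (Hi : forall z, z ∈ i <-> z ∈ a /\ z ∈ b) by (apply in_sep; dfn_tac).
  assert (Oi : is_ordinal i).
  { apply ordinal_intro.
    - intros y Hy z Hz; apply Hi in Hy as [H1 H2]; apply Hi.
      split; eapply ord_trans; eauto.
    - intros y z Hy Hz; apply Hi in Hy, Hz; apply (proj1 (proj2 Ha)); tauto. }
  destruct (ord_subset i a) as [Hia|Hia]; auto; [intro; rewrite Hi; tauto| |].
  - destruct (ord_subset i b) as [Hib|Hib]; auto; [intro; rewrite Hi; tauto| |].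
    + destruct (mem_irrefl i); apply Hi; auto.
    + rewrite <- Hib; auto.
  - destruct (ord_subset i b) as [Hib|Hib]; auto; [intro; rewrite Hi; tauto| |].
    + rewrite <- Hia; auto.
    + right; left; congruence.
Qed.

Lemma ord_le_refl a : ord_le a a.
Proof. right; reflexivity. Qed.

Lemma ord_lt_le a b : a ∈ b -> ord_le a b.
Proof. left; assumption. Qed.

Lemma ord_le_or_lt a b : is_ordinal a -> is_ordinal b -> ord_le a b \/ b ∈ a.
Proof. intros Ha Hb; unfold ord_le; destruct (ord_trichotomy a b); tauto. Qed.

Lemma lt_le_trans a b c : is_ordinal c -> a ∈ b -> ord_le b c -> a ∈ c.
Proof. intros Hc Hab [H| <-]; [eapply ord_trans; eauto|exact Hab]. Qed.

Lemma le_lt_trans a b c : is_ordinal c -> ord_le a b -> b ∈ c -> a ∈ c.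
Proof. intros Hc [H| ->] Hbc; [eapply ord_trans; eauto|exact Hbc]. Qed.

Lemma le_trans a b c : is_ordinal c -> ord_le a b -> ord_le b c -> ord_le a c.
Proof. intros Hc [H| ->] Hbc; [left; eapply lt_le_trans; eauto|exact Hbc]. Qed.

Lemma le_not_lt a b : ord_le a b -> b ∉ a.
Proof. intros [H| ->]; [apply mem_asym; auto|apply mem_irrefl]. Qed.

Lemma le_antisym a b : ord_le a b -> ord_le b a -> a = b.
Proof. intros [H| ->]; auto; intros [H'|H']; auto; destruct (mem_asym a b); auto. Qed.

Lemma le_subset a b : is_ordinal b -> ord_le a b -> subset a b.
Proof. intros Hb H z Hz; eapply lt_le_trans; eauto. Qed.

Lemma ord_empty : is_ordinal empty.
Proof.
  apply ordinal_intro; [intros y Hy|intros y z Hy]; destruct (in_empty _ Hy).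
Qed.

Lemma ord_succ a : is_ordinal a -> is_ordinal (succ a).
Proof.
  intro Ha; apply ordinal_intro.
  - intros y Hy z Hz; apply in_succ; left.
    apply in_succ in Hy as [Hy| ->]; auto; eapply ord_trans; eauto.
  - intros y z Hy Hz; apply ord_trichotomy.
    + apply in_succ in Hy as [Hy| ->]; auto; eapply ord_elem; eauto.
    + apply in_succ in Hz as [Hz| ->]; auto; eapply ord_elem; eauto.
Qed.

Lemma ord_set_intro x : transitive_set x -> (forall y, y ∈ x -> is_ordinal y) ->
  is_ordinal x.
Proof. intros T H; apply ordinal_intro; auto using ord_trichotomy. Qed.

Lemma ord_bigcup x : (forall y, y ∈ x -> is_ordinal y) -> is_ordinal (bigcup x).
Proof.
  intro H; apply ord_set_intro.
  - intros y Hy z Hz; apply in_bigcup in Hy as (w & Hw & Hy); apply in_bigcup.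
    exists w; split; auto; eapply ord_trans; eauto.
  - intros y Hy; apply in_bigcup in Hy as (w & Hw & Hy); eapply ord_elem; eauto.
Qed.

Lemma le_bigcup x y : (forall y, y ∈ x -> is_ordinal y) -> y ∈ x -> ord_le y (bigcup x).
Proof.
  intros H Hy; apply ord_subset; auto using ord_bigcup.
  intros z Hz; apply in_bigcup; eauto.
Qed.

Lemma succ_le a b : is_ordinal a -> is_ordinal b -> a ∈ b -> ord_le (succ a) b.
Proof.
  intros Ha Hb H; apply ord_subset; auto using ord_succ.
  intros z Hz; apply in_succ in Hz as [Hz| ->]; auto; eapply ord_trans; eauto.
Qed.

Lemma lt_succ a b : b ∈ succ a <-> ord_le b a.
Proof. apply in_succ. Qed.

Lemma lt_succ_diag a : a ∈ succ a.
Proof. apply in_succ; auto. Qed.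

Lemma ord_ub2 a b : is_ordinal a -> is_ordinal b ->
  exists c, (c = a \/ c = b) /\ is_ordinal c /\ ord_le a c /\ ord_le b c.
Proof.
  intros Ha Hb; destruct (ord_le_or_lt a b) as [H|H]; auto.
  - exists b; auto using ord_le_refl.
  - exists a; auto using ord_le_refl, ord_lt_le.
Qed.

Lemma least_exists (P : V -> Prop) a : dfn_any P -> is_ordinal a -> P a ->
  exists m, is_ordinal m /\ P m /\ (forall y, y ∈ m -> ~ P y) /\ ord_le m a.
Proof.
  intros HP Ha Pa.
  destruct (foundation (setof (fun z => z ∈ succ a /\ P z))) as (m & Hm & Hmin).
  { exists a; apply in_sep; [exact HP|auto using lt_succ_diag]. }
  apply in_sep in Hm as [Hm Pm]; auto.
  assert (Om : is_ordinal m) by (apply (ord_elem (succ a)); auto using ord_succ).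
  exists m; splits; auto.
  - intros y Hy Py; apply (Hmin y); auto; apply in_sep; auto.
    split; auto; eapply ord_trans; eauto using ord_succ.
  - apply lt_succ; auto.
Qed.

Lemma least_eq (P : V -> Prop) m : is_ordinal m -> P m -> (forall y, y ∈ m -> ~ P y) ->
  least P = m.
Proof.
  intros Om Pm Hm; apply iota_eq; auto.
  intros y (Oy & Py & Hy); destruct (ord_trichotomy y m) as [H|[H|H]]; auto.
  - destruct (Hm y); auto.
  - destruct (Hy m); auto.
Qed.

Lemma least_spec (P : V -> Prop) : dfn_any P -> (exists a, is_ordinal a /\ P a) ->
  is_ordinal (least P) /\ P (least P) /\
  forall y, is_ordinal y -> P y -> ord_le (least P) y.
Proof.
  intros HP (a & Ha & Pa); destruct (least_exists P a) as (m & Om & Pm & Hm & _); auto.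
  rewrite (least_eq P m); auto; splits; auto.
  intros y Oy Py; destruct (ord_le_or_lt m y) as [|H]; auto; destruct (Hm y H Py).
Qed.

Lemma ord_ind (P : V -> Prop) : dfn_any P ->
  (forall a, is_ordinal a -> (forall b, b ∈ a -> P b) -> P a) ->
  forall a, is_ordinal a -> P a.
Proof.
  intros HP IH a Ha; apply NNPP; intro N.
  destruct (least_exists (fun x => ~ P x) a) as (m & Om & Nm & Hm & _); auto.
  { dfn_tac. }
  apply Nm, IH; auto; intros b Hb; apply NNPP; apply Hm; auto.
Qed.

(** Collection for ordinals: replacement applies to the least witnesses, and g is their supremum. *)
Lemma bounding (R : V -> V -> Prop) a : dfn Any (fun e => R (e 0) (e 1)) ->
  (forall x, x ∈ a -> exists b, is_ordinal b /\ R x b) ->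
  exists g, is_ordinal g /\ forall x, x ∈ a -> exists b, ord_le b g /\ is_ordinal b /\ R x b.
Proof.
  intros HR H.
  pose (t := fun x => least (R x)).
  assert (HR2 : forall t u, dtm Any t -> dtm Any u -> dfn Any (fun e => R (t e) (u e))).
  { apply dfn_app2; exact HR. }
  assert (Ht : dtm_any t) by (unfold t; dfn_tac).
  assert (L : forall x, x ∈ a -> is_ordinal (t x) /\ R x (t x)).
  { intros x Hx; destruct (least_spec (R x)) as (H1 & H2 & _); auto; dfn_tac. }
  assert (O : forall y, y ∈ image t a -> is_ordinal y).
  { intros y Hy; apply in_image in Hy as (x & Hx & ->); auto; apply L; auto. }
  exists (bigcup (image t a)); split; [apply ord_bigcup; auto|].
  intros x Hx; exists (t x); split; [|apply L; auto].
  apply le_bigcup; auto; apply in_image; eauto.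
Qed.

(** * Recursion *)

Lemma in_graph (t : V -> V) a : dtm_any t ->
  forall p, p ∈ graph t a <-> exists x, x ∈ a /\ p = opair x (t x).
Proof.
  intros Ht; apply (in_image a (fun x => opair x (t x))); dfn_tac.
Qed.

Lemma maps_graph (t : V -> V) a x y : dtm_any t ->
  maps (graph t a) x y <-> x ∈ a /\ y = t x.
Proof.
  intro Ht; rewrite maps_iff, in_graph; auto; split.
  - intros (z & Hz & E); apply opair_inj in E as [-> ->]; auto.
  - intros [Hx ->]; eauto.
Qed.

Definition restrict s a := setof (fun p => p ∈ s /\ exists x y, x ∈ a /\ p = opair x y).

Lemma in_restrict s a p :
  p ∈ restrict s a <-> p ∈ s /\ exists x y, x ∈ a /\ p = opair x y.
Proof.
  apply (in_sep s (fun p => exists x y, x ∈ a /\ p = opair x y)); dfn_tac.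
Qed.

(** [H b s] is the value of the recursively defined function with parameter [b]
    at an ordinal at which its restriction is [s]. *)
Definition attempt (H : V -> V -> V) b a s :=
  s = graph (fun x => H b (restrict s x)) a.

Definition rec (H : V -> V -> V) b a := H b (iota (attempt H b a)).

(** Two attempts on a agree below every x <= a ([Au]), and the graph of [rec] is itself an attempt
    ([K]), so the [iota] inside [rec] finds exactly this graph. *)
Lemma rec_eq (H : V -> V -> V) b : dtm Any (fun e => H b (e 0)) ->
  dtm_any (rec H b) /\
  forall a, is_ordinal a -> rec H b a = H b (graph (rec H b) a).
Proof.
  intro HH.
  assert (H1 : forall t, dtm Any t -> dtm Any (fun e => H b (t e))) by (apply dtm_app1; exact HH).
  assert (HR : forall t u, dtm Any t -> dtm Any u -> dtm Any (fun e => restrict (t e) (u e))).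
  { apply dtm_app2; unfold restrict; dfn_tac. }
  assert (HA : forall t u, dtm Any t -> dtm Any u -> dfn Any (fun e => attempt H b (t e) (u e))).
  { apply dfn_app2; unfold attempt; dfn_tac. }
  assert (Hrec : dtm_any (rec H b)) by (unfold rec; dfn_tac).
  assert (Hrec1 : forall t, dtm Any t -> dtm Any (fun e => rec H b (t e))) by (apply dtm_app1; exact Hrec).
  assert (mapsA : forall a s x y, attempt H b a s ->
    opair x y ∈ s <-> x ∈ a /\ y = H b (restrict s x)).
  { intros a s x y Hs; unfold attempt in Hs.
    assert (E : dtm_any (fun x => H b (restrict s x))) by dfn_tac.
    apply (maps_graph _ a x y) in E; rewrite <- Hs, maps_iff in E; exact E. }
  assert (Au : forall a s s', is_ordinal a -> attempt H b a s -> attempt H b a s' ->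
    forall x, is_ordinal x -> ord_le x a -> restrict s x = restrict s' x).
  { intros a s s' Oa Hs Hs'; apply (ord_ind (fun x => ord_le x a -> restrict s x = restrict s' x)).
    { dfn_tac. }
    intros x Ox IH Hx; apply ext; intro p; rewrite !in_restrict.
    assert (IH' : forall y, y ∈ x -> restrict s y = restrict s' y).
    { intros y Hy; apply IH; auto; left; eapply lt_le_trans; eauto. }
    split; intros (Hp & y & z & Hy & ->); (split; [|eauto]).
    - rewrite mapsA in Hp |- *; eauto; rewrite <- IH'; auto.
    - rewrite mapsA in Hp |- *; eauto; rewrite IH'; auto. }
  assert (full : forall a s, attempt H b a s -> restrict s a = s).
  { intros a s Hs; apply ext; intro p; rewrite in_restrict; split; [tauto|].
    intro Hp; split; auto; unfold attempt in Hs; rewrite Hs, in_graph in Hp; [|dfn_tac].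
    destruct Hp as (x & Hx & ->); eauto. }
  assert (K : forall a, is_ordinal a -> attempt H b a (graph (rec H b) a)).
  { apply (ord_ind (fun a => attempt H b a (graph (rec H b) a))); [dfn_tac|].
    intros a Oa IH.
    assert (R : forall x, x ∈ a -> restrict (graph (rec H b) a) x = graph (rec H b) x).
    { intros x Hx; apply ext; intro p; rewrite in_restrict, !in_graph; auto; split.
      - intros ((y & Hy & ->) & u & v & Hu & E); apply opair_inj in E as [-> <-]; eauto.
      - intros (y & Hy & ->); split; [|eauto]; exists y; split; auto; eapply ord_trans; eauto. }
    unfold attempt; apply ext; intro p; rewrite !in_graph; auto; [|dfn_tac].
    assert (E : forall x, x ∈ a -> rec H b x = H b (restrict (graph (rec H b) a) x)).
    { intros x Hx; unfold rec at 1; f_equal; rewrite R; auto.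
      apply iota_eq; [apply IH; auto|]; intros s Hs.
      assert (Ox : is_ordinal x) by (eapply ord_elem; eauto).
      rewrite <- (full x s), <- (full x (graph (rec H b) x)); auto.
      apply (Au x); auto using ord_le_refl. }
    split; intros (x & Hx & ->); exists x; split; auto; rewrite <- E; auto. }
  split; [exact Hrec|].
  intros a Oa; unfold rec at 1; f_equal; apply iota_eq; [apply K; auto|].
  intros s Hs; rewrite <- (full a s), <- (full a (graph (rec H b) a)); auto.
  apply (Au a); auto using ord_le_refl.
Qed.

(** Recursion adds no constants, so a recursion that is definable from ordinals stays so. *)
Lemma dtm_rec Q (H : V -> V -> V) : dtm Q (fun e => H (e 0) (e 1)) ->
  forall t u, dtm Q t -> dtm Q u -> dtm Q (fun e => rec H (t e) (u e)).
Proof.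
  intro HH; apply dtm_app2; unfold rec, attempt, restrict.
  assert (H2 : forall t u, dtm Q t -> dtm Q u -> dtm Q (fun e => H (t e) (u e))).
  { apply dtm_app2; exact HH. }
  dfn_tac.
Qed.

End Ordinals.

(** * Natural numbers of V and iteration along omega *)

Section Omega.
Context {V : estruct} {zfcV : ZFC V}.
Implicit Types x y z a b c n s p f : V.

Lemma is_succ_iff y x : is_succ y x <-> y = succ x.
Proof.
  split; [|intros -> z; apply in_succ].
  intro H; apply ext; intro z; rewrite in_succ; apply H.
Qed.

Lemma succ_inj a b : succ a = succ b -> a = b.
Proof.
  intro H.
  assert (H1 : a ∈ succ b) by (rewrite <- H; apply lt_succ_diag).
  assert (H2 : b ∈ succ a) by (rewrite H; apply lt_succ_diag).
  apply le_antisym; apply lt_succ; auto.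
Qed.

(** Finiteness expressed without mention of [omega], which is then defined from it. *)
Definition is_nat n :=
  is_ordinal n /\ forall a, a ∈ succ n -> a = empty \/ exists c, a = succ c.

Lemma dfn_is_nat Q t : dtm Q t -> dfn Q (fun e => is_nat (t e)).
Proof. apply (dfn_app1 (fun x e => is_nat x)); unfold is_nat; dfn_tac. Qed.
Hint Resolve dfn_is_nat : dfn.

Definition omega := setof is_nat.

Lemma in_omega n : n ∈ omega <-> is_nat n.
Proof.
  unfold omega; apply in_setof.
  (* The inductive set given by infinity contains every natural number, by induction on ordinals; so
     they form a set. *)
  destruct (zfc_infinity zfcV) as (w & (e & He & Hew) & Hw).
  apply (set_exists_bound w); [dfn_tac|].
  assert (E : e = empty).
  { apply ext; intro z; split; intro H; [destruct (He z H)|destruct (in_empty z H)]. }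
  intros m Hm; pose proof (proj1 Hm) as Om; revert m Om Hm.
  apply (ord_ind (fun m => is_nat m -> m ∈ w)); [dfn_tac|].
  intros m Om IH [_ Hm].
  destruct (Hm m (lt_succ_diag m)) as [-> |[c ->]]; [congruence|].
  destruct (Hw c) as (y & Hy & Hyw).
  - apply IH; [apply lt_succ_diag|split].
    + apply (ord_elem (succ c)); auto; apply lt_succ_diag.
    + intros a Ha; apply Hm; apply in_succ; auto.
  - apply is_succ_iff in Hy; subst; auto.
Qed.

Lemma zero_in_omega : empty ∈ omega.
Proof.
  apply in_omega; split; [apply ord_empty|].
  intros a Ha; apply in_succ in Ha as [Ha| ->]; auto; destruct (in_empty a Ha).
Qed.

Lemma succ_in_omega n : n ∈ omega -> succ n ∈ omega.
Proof.
  rewrite !in_omega; intros [On Hn]; split; [apply ord_succ, On|].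
  intros a Ha; apply in_succ in Ha as [Ha| ->]; eauto.
Qed.

Lemma ord_omega : is_ordinal omega.
Proof.
  apply ord_set_intro; [|intros y Hy; apply in_omega in Hy; apply Hy].
  intros y Hy z Hz; apply in_omega in Hy as [Oy Hy]; apply in_omega.
  assert (Oz : is_ordinal z) by (apply (ord_elem y); auto).
  split; [exact Oz|].
  intros a Ha; apply Hy; apply in_succ; left; apply in_succ in Ha as [Ha| ->]; auto.
  eapply ord_trans; eauto.
Qed.

Lemma is_limit_succ l a : is_limit l -> a ∈ l -> succ a ∈ l.
Proof.
  intros (Ol & _ & H) Ha; destruct (H a Ha) as (y & Hy & Hay).
  assert (Oa : is_ordinal a) by (apply (ord_elem l); auto).
  apply (le_lt_trans (succ a) y l); auto; apply succ_le; auto; apply (ord_elem l); auto.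
Qed.

Lemma is_omega_iff w : is_omega w <-> w = omega.
Proof.
  assert (L : is_limit omega).
  { split; [apply ord_omega|split; [exists empty; apply zero_in_omega|]].
    intros x Hx; exists (succ x); split; [apply succ_in_omega, Hx|apply lt_succ_diag]. }
  assert (N : forall a, a ∈ omega -> ~ is_limit a).
  { intros a Ha La; apply in_omega in Ha as [Oa Ha].
    destruct (Ha a (lt_succ_diag a)) as [-> |[c ->]].
    - destruct La as (_ & (x & Hx) & _); destruct (in_empty x Hx).
    - apply (mem_irrefl (succ c)), is_limit_succ; auto; apply lt_succ_diag. }
  split; [|intros ->; split; auto].
  intros [Lw Nw]; destruct (ord_trichotomy w omega) as [H|[H|H]]; auto.
  - apply Lw.
  - apply ord_omega.
  - destruct (N w H Lw).
  - destruct (Nw omega H L).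
Qed.

Lemma omega_ind (P : V -> Prop) : dfn_any P -> P empty ->
  (forall n, n ∈ omega -> P n -> P (succ n)) -> forall n, n ∈ omega -> P n.
Proof.
  intros HP H0 HS n Hn.
  assert (On : is_ordinal n) by (apply in_omega in Hn; apply Hn).
  revert n On Hn; apply (ord_ind (fun n => n ∈ omega -> P n)).
  { unfold omega; dfn_tac. }
  intros n On IH Hn; pose proof Hn as Hn'; apply in_omega in Hn' as [_ H].
  destruct (H n (lt_succ_diag n)) as [-> |[c ->]]; auto.
  assert (Hc : c ∈ omega).
  { eapply ord_trans; [apply ord_omega|apply lt_succ_diag|exact Hn]. }
  apply HS; auto; apply IH; auto; apply lt_succ_diag.
Qed.

(** The largest index at which s is defined is the predecessor of the current stage; an empty s
    marks stage 0. *)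
Definition iter_step (St : V -> V) x s := iota (fun y =>
  ((forall j z, ~ maps s j z) /\ y = x) \/
  exists j z, maps s j z /\ (forall j' z', maps s j' z' -> ord_le j' j) /\ y = St z).

Definition iter (St : V -> V) x n := rec (iter_step St) x n.

Lemma iter_eq St x : dtm_any St ->
  iter St x empty = x /\ forall n, n ∈ omega -> iter St x (succ n) = St (iter St x n).
Proof.
  intro HS.
  assert (HS1 : forall t, dtm Any t -> dtm Any (fun e => St (t e))) by (apply dtm_app1; exact HS).
  destruct (rec_eq (iter_step St) x) as [Hd Hr]; [unfold iter_step; dfn_tac|].
  unfold iter; split.
  - rewrite (Hr empty ord_empty); apply iota_eq.
    + left; split; auto; intros j z Hj; apply maps_graph in Hj as [Hj _]; auto.
      destruct (in_empty j Hj).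
    + intros y [[_ Hy]|(j & z & Hj & _)]; auto.
      apply maps_graph in Hj as [Hj _]; auto; destruct (in_empty j Hj).
  - intros n Hn; assert (On : is_ordinal n) by (apply in_omega in Hn; apply Hn).
    rewrite (Hr (succ n)) by (apply ord_succ, On); apply iota_eq.
    + right; exists n, (rec (iter_step St) x n); splits; auto.
      * apply maps_graph; auto; split; auto; apply lt_succ_diag.
      * intros j' z' Hj; apply maps_graph in Hj as [Hj _]; auto; apply lt_succ; auto.
    + intros y [[H _]|(j & z & Hj & H & ->)].
      * destruct (H n (rec (iter_step St) x n)); apply maps_graph; auto.
        split; auto; apply lt_succ_diag.
      * apply maps_graph in Hj as [Hj ->]; auto; apply lt_succ in Hj.
        f_equal; f_equal; apply le_antisym; auto.
        apply (H n (rec (iter_step St) x n)); apply maps_graph; auto.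
        split; auto; apply lt_succ_diag.
Qed.

Lemma dtm_iter Q (St : V -> V) : dtm Q (fun e => St (e 0)) ->
  forall t u, dtm Q t -> dtm Q u -> dtm Q (fun e => iter St (t e) (u e)).
Proof.
  intro HS; apply (dtm_rec Q (iter_step St)); unfold iter_step.
  assert (HS1 : forall t, dtm Q t -> dtm Q (fun e => St (t e))) by (apply dtm_app1; exact HS).
  dfn_tac.
Qed.

Lemma dtm_omega Q : dtm Q (fun _ => omega).
Proof. unfold omega; dfn_tac. Qed.
End Omega.

#[export] Hint Resolve dtm_omega : dfn.

(** * Foundation for classes, the cumulative hierarchy, closure points *)

Section Rank.
Context {V : estruct} {zfcV : ZFC V}.
Implicit Types x y z a b c n s p f : V.

(** Iterating the union from {x} gives the transitive closure t of {x}; foundation is applied to the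
    part of t in [P]. *)
Lemma class_minimal (P : V -> Prop) : dfn_any P -> (exists x, P x) ->
  exists y, P y /\ forall z, z ∈ y -> ~ P z.
Proof.
  intros HP [x Px].
  assert (HF : dtm_any (iter bigcup (upair x x))) by (apply dtm_iter; dfn_tac).
  destruct (iter_eq bigcup (upair x x)) as [I0 IS]; [dfn_tac|].
  pose (t := bigcup (image (iter bigcup (upair x x)) omega)).
  assert (Ht : forall y, y ∈ t <-> exists n, n ∈ omega /\ y ∈ iter bigcup (upair x x) n).
  { intro y; unfold t; rewrite in_bigcup; split.
    - intros (v & Hv & Hy); apply in_image in Hv as (n & Hn & ->); eauto.
    - intros (n & Hn & Hy); eexists; split; [apply in_image; eauto|exact Hy]. }
  destruct (foundation (setof (fun z => z ∈ t /\ P z))) as (m & Hm & Hmin).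
  { exists x; apply in_sep; auto; split; auto; apply Ht; exists empty.
    split; [apply zero_in_omega|]; rewrite I0; apply in_upair; auto. }
  apply in_sep in Hm as [Hm Pm]; auto; exists m; split; auto; intros z Hz Pz.
  apply (Hmin z); auto; apply in_sep; auto; split; auto.
  apply Ht in Hm as (n & Hn & Hm); apply Ht; exists (succ n).
  split; [apply succ_in_omega, Hn|]; rewrite IS; auto; apply in_bigcup; eauto.
Qed.

Definition rank_step (_ s : V) := setof (fun z => exists j v, maps s j v /\ subset z v).
Definition Vr b := rec rank_step empty b.

Lemma dtm_Vr Q t : dtm Q t -> dtm Q (fun e => Vr (t e)).
Proof. intro Ht; apply (dtm_rec Q rank_step); unfold rank_step; dfn_tac. Qed.
Hint Resolve dtm_Vr : dfn.

Lemma in_Vr b z : is_ordinal b -> z ∈ Vr b <-> exists d, d ∈ b /\ subset z (Vr d).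
Proof.
  intro Ob; destruct (rec_eq rank_step empty) as [Hd Hr]; [unfold rank_step; dfn_tac|].
  unfold Vr at 1; rewrite (Hr b Ob); unfold rank_step at 1; rewrite in_setof.
  - split.
    + intros (j & v & Hj & Hz); apply maps_graph in Hj as [Hj ->]; eauto.
    + intros (d & Hdb & Hz); exists d, (Vr d); split; auto; apply maps_graph; auto.
  - set (s := graph (rec rank_step empty) b).
    (* With Kuratowski pairs, two unions of s reach its values v, and a third their elements. *)
    apply (set_exists_bound (power (bigcup (bigcup (bigcup s))))); [dfn_tac|].
    intros y (j & v & Hj & Hy); apply in_power; intros w Hw; apply maps_iff in Hj.
    apply in_bigcup; exists v; split; auto; apply in_bigcup.
    exists (upair j v); split; [|apply in_upair; auto].
    apply in_bigcup; exists (opair j v); split; auto; apply in_upair; auto.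
Qed.

Lemma Vr_mono a b : is_ordinal a -> is_ordinal b -> ord_le a b -> subset (Vr a) (Vr b).
Proof.
  intros Oa Ob H z Hz; apply in_Vr in Hz as (d & Hd & Hz); auto.
  apply in_Vr; auto; exists d; split; auto; eapply lt_le_trans; eauto.
Qed.

Lemma Vr_trans b y z : is_ordinal b -> y ∈ z -> z ∈ Vr b -> y ∈ Vr b.
Proof.
  intros Ob Hy Hz; apply in_Vr in Hz as (d & Hd & Hz); auto.
  apply (Vr_mono d b); auto using ord_lt_le; apply (ord_elem b); auto.
Qed.

Lemma in_Vr_succ a z : is_ordinal a -> subset z (Vr a) -> z ∈ Vr (succ a).
Proof.
  intros Oa H; apply in_Vr; [apply ord_succ, Oa|]; exists a; split; auto.
  apply lt_succ_diag.
Qed.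

Lemma ord_subset_Vr a : is_ordinal a -> subset a (Vr a).
Proof.
  revert a; apply (ord_ind (fun a => subset a (Vr a))); [dfn_tac|].
  intros a Oa IH z Hz; apply in_Vr; eauto.
Qed.

Lemma Vr_exists x : exists b, is_ordinal b /\ x ∈ Vr b.
Proof.
  apply NNPP; intro N.
  destruct (class_minimal (fun x => ~ exists b, is_ordinal b /\ x ∈ Vr b))
    as (y & Ny & Hy); [dfn_tac|eauto|].
  destruct (bounding (fun x b => x ∈ Vr b) y) as (g & Og & Hg); [dfn_tac| |].
  - intros z Hz; apply NNPP; intro N'; apply (Hy z Hz); auto.
  - apply Ny; exists (succ g); split; [apply ord_succ, Og|].
    apply in_Vr_succ; auto; intros z Hz.
    destruct (Hg z Hz) as (b & Hb & Ob & Hzb); apply (Vr_mono b g); auto.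
Qed.

Lemma is_rank_level_iff b x : is_ordinal b -> is_rank_level b x <-> x = Vr b.
Proof.
  intro Ob; split.
  - intros (h & Hu & He & Hx).
    enough (K : forall c, is_ordinal c -> ord_le c b -> forall y, maps h c y -> y = Vr c).
    { apply (K b); auto using ord_le_refl. }
    apply (ord_ind (fun c => ord_le c b -> forall y, maps h c y -> y = Vr c)); [dfn_tac|].
    intros c Oc IH Hc y Hy.
    destruct (He c Hc) as (y' & Hy' & E); replace y' with y in E by (eapply Hu; eauto).
    assert (Hlt : forall d, d ∈ c -> ord_le d b) by (intros d Hd; left; eapply lt_le_trans; eauto).
    apply ext; intro z; rewrite E, in_Vr; auto; split.
    + intros (d & v & Hd & Hv & Hz); exists d; split; auto.
      rewrite <- (IH d Hd (Hlt d Hd) v Hv); exact Hz.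
    + intros (d & Hd & Hz); destruct (He d (Hlt d Hd)) as (v & Hv & _).
      exists d, v; splits; auto; rewrite (IH d Hd (Hlt d Hd) v Hv); exact Hz.
  - intros ->; exists (graph Vr (succ b)).
    assert (M : forall c y, maps (graph Vr (succ b)) c y <-> c ∈ succ b /\ y = Vr c).
    { intros; apply maps_graph; dfn_tac. }
    splits.
    + intros c y y' H1 H2; apply M in H1, H2; intuition congruence.
    + intros c Hc; exists (Vr c); split; [apply M; split; auto; apply lt_succ; auto|].
      assert (Oc : is_ordinal c).
      { apply (ord_elem (succ b)); [apply ord_succ, Ob|apply lt_succ; auto]. }
      intro z; rewrite in_Vr; auto; split.
      * intros (d & Hd & Hz); exists d, (Vr d); splits; auto; apply M; split; auto.
        eapply ord_trans; [apply ord_succ, Ob|exact Hd|apply lt_succ, Hc].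
      * intros (d & v & Hd & Hv & Hz); apply M in Hv as [_ ->]; eauto.
    + apply M; split; auto; apply lt_succ_diag.
Qed.

Lemma in_Vr_limit l z : is_limit l -> z ∈ Vr l <-> exists d, d ∈ l /\ z ∈ Vr d.
Proof.
  intro Ll; pose proof (proj1 Ll) as Ol; rewrite in_Vr; auto; split.
  - intros (d & Hd & Hz); exists (succ d); split; [apply is_limit_succ; auto|].
    apply in_Vr_succ; auto; apply (ord_elem l); auto.
  - intros (d & Hd & Hz); exists d; split; auto; intros w Hw.
    apply (Vr_trans d w z); auto; apply (ord_elem l); auto.
Qed.

Lemma upair_Vr l x y : is_limit l -> x ∈ Vr l -> y ∈ Vr l -> upair x y ∈ Vr l.
Proof.
  intros Ll Hx Hy; pose proof (proj1 Ll) as Ol.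
  apply in_Vr_limit in Hx as (a & Ha & Hx), Hy as (b & Hb & Hy); auto.
  assert (Oa : is_ordinal a) by (apply (ord_elem l); auto).
  assert (Ob : is_ordinal b) by (apply (ord_elem l); auto).
  destruct (ord_ub2 a b) as (c & Hc & Oc & Hac & Hbc); auto.
  apply in_Vr; auto; exists c; split; [destruct Hc as [-> | ->]; auto|].
  intros z Hz; apply in_upair in Hz as [-> | ->];
    [apply (Vr_mono a c)|apply (Vr_mono b c)]; auto.
Qed.

Lemma opair_Vr l x y : is_limit l -> x ∈ Vr l -> y ∈ Vr l -> opair x y ∈ Vr l.
Proof. intros; repeat apply upair_Vr; auto. Qed.

(** [K] will be the class of all ordinals or the set of ordinals below kappa. *)
Lemma closing (K : V -> Prop) (R : V -> V -> Prop) :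
  dfn_any K -> (forall x, K x -> is_ordinal x) -> (forall x y, K x -> y ∈ x -> K y) ->
  (forall F, dtm_any F -> (forall n, n ∈ omega -> K (F n)) ->
    exists b, K b /\ forall n, n ∈ omega -> F n ∈ b) ->
  dfn Any (fun e => R (e 0) (e 1)) ->
  (forall x, K x -> exists y, K y /\ x ∈ y /\ R x y) ->
  forall a, K a -> exists l, K l /\ a ∈ l /\ is_limit l /\
    (forall x, x ∈ l -> exists z y, ord_le x z /\ z ∈ y /\ y ∈ l /\ R z y) /\
    exists g, is_cofinal_map g omega l.
Proof.
  intros HK KO Kdown Kb HR KR a Ka.
  assert (HK1 : forall t, dtm Any t -> dfn Any (fun e => K (t e))).
  { intros t Ht; exact (dfn_app1 (fun x e => K x) t HK Ht). }
  assert (HR1 : forall t u, dtm Any t -> dtm Any u -> dfn Any (fun e => R (t e) (u e))).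
  { apply dfn_app2; exact HR. }
  (* Taking the least next point makes the step a definable function, so it can be iterated; the
     iterates below are cofinal in their supremum l. *)
  pose (St := fun x => least (fun y => K y /\ x ∈ y /\ R x y)).
  assert (HS : dtm_any St) by (unfold St; dfn_tac).
  assert (SS : forall x, K x -> K (St x) /\ x ∈ St x /\ R x (St x)).
  { intros x Hx; destruct (least_spec (fun y => K y /\ x ∈ y /\ R x y)) as (_ & H & _).
    - dfn_tac.
    - destruct (KR x Hx) as (y & Hy & H); eauto.
    - exact H. }
  pose (F := iter St a).
  assert (HF : dtm_any F) by (unfold F; apply dtm_iter; dfn_tac).
  assert (HF1 : forall t, dtm Any t -> dtm Any (fun e => F (t e))) by (apply dtm_app1; exact HF).
  destruct (iter_eq St a HS) as [F0 FS]; fold F in F0, FS.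
  assert (KF : forall n, n ∈ omega -> K (F n)).
  { apply omega_ind; [dfn_tac|rewrite F0; auto|].
    intros n Hn H; rewrite FS; auto; apply SS; auto. }
  assert (Fs : forall n, n ∈ omega -> F n ∈ F (succ n) /\ R (F n) (F (succ n))).
  { intros n Hn; rewrite FS; auto; apply SS; auto. }
  pose (l := bigcup (image F omega)).
  assert (Hl : forall x, x ∈ l <-> exists n, n ∈ omega /\ x ∈ F n).
  { intro x; unfold l; rewrite in_bigcup; split.
    - intros (v & Hv & Hx); apply in_image in Hv as (n & Hn & ->); eauto.
    - intros (n & Hn & Hx); eexists; split; [apply in_image; eauto|exact Hx]. }
  assert (Ol : is_ordinal l).
  { apply ord_bigcup; intros y Hy; apply in_image in Hy as (n & Hn & ->); auto. }
  assert (Fl : forall n, n ∈ omega -> F n ∈ l).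
  { intros n Hn; apply Hl; exists (succ n); split; [apply succ_in_omega, Hn|apply Fs, Hn]. }
  exists l; splits.
  - destruct (Kb F HF KF) as (b & Hb & Hbn).
    assert (H : ord_le l b).
    { apply ord_subset; auto; intros x Hx; apply Hl in Hx as (n & Hn & Hx).
      eapply ord_trans; eauto. }
    destruct H as [H| ->]; eauto.
  - rewrite <- F0; apply Fl, zero_in_omega.
  - split; [exact Ol|split; [exists (F empty); apply Fl, zero_in_omega|]].
    intros x Hx; apply Hl in Hx as (n & Hn & Hx); exists (F n); auto.
  - intros x Hx; apply Hl in Hx as (n & Hn & Hx); exists (F n), (F (succ n)).
    splits; auto using ord_lt_le; try apply Fs; auto; apply Fl, succ_in_omega, Hn.
  - assert (M : forall n y, maps (graph F omega) n y <-> n ∈ omega /\ y = F n).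
    { intros; apply maps_graph; dfn_tac. }
    exists (graph F omega); split; [split|].
    + intros p Hp; apply in_graph in Hp as (n & Hn & ->); auto.
      exists n, (F n); splits; auto; apply is_opair_iff; auto.
    + intros n Hn; exists (F n); split; [apply M; auto|].
      intros y Hy; apply M in Hy as [_ ->]; auto.
    + intros x Hx; apply Hl in Hx as (n & Hn & Hx); exists n, (F n).
      split; [apply M; auto|apply ord_lt_le, Hx].
Qed.

End Rank.
#[export] Hint Resolve dtm_Vr : dfn.

(** * Reflection and ordinal definability *)

Section Reflection.
Context {V : estruct} {zfcV : ZFC V}.
Implicit Types x y z a b c n s p f u l : V.

(** The nested pair [(x_0, (x_1, ...))] codes an environment. *)
Fixpoint drop (i : nat) u := match i with 0 => u | S i => drop i (snd u) end.
Definition env u (i : nat) := fst (drop i u).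
Fixpoint tup (e : nat -> V) (n : nat) :=
  match n with 0 => empty | S n => opair (e 0) (tup (fun i => e (S i)) n) end.

Lemma env_cons x u i : env (opair x u) i = scons x (env u) i.
Proof.
  unfold env; destruct i; simpl; [apply fst_opair|rewrite snd_opair; reflexivity].
Qed.

Lemma env_tup (n : nat) : forall e i, i < n -> env (tup e n) i = e i.
Proof.
  induction n as [|n IH]; intros e i Hi; [lia|].
  simpl tup; rewrite env_cons; destruct i; simpl; [reflexivity|apply (IH (fun i => e (S i))); lia].
Qed.

Lemma dtm_env Q i (t : (nat -> V) -> V) : dtm Q t -> dtm Q (fun e => env (t e) i).
Proof.
  intro Ht; unfold env; apply dtm_fst; revert t Ht.
  induction i as [|i IH]; intros t Ht; simpl; [exact Ht|].
  apply (IH (fun e => snd (t e))); dfn_tac.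
Qed.

Lemma tup_Vr l (n : nat) : is_limit l -> forall e, (forall i, e i ∈ Vr l) -> tup e n ∈ Vr l.
Proof.
  intro Ll; induction n as [|n IH]; intros e He; simpl.
  - destruct Ll as (Ol & (x & Hx) & _); apply in_Vr; auto; exists x; split; auto.
    intros z Hz; destruct (in_empty z Hz).
  - apply opair_Vr; auto.
Qed.

Lemma dfn_sat_env (a : form) (t u : (nat -> V) -> V) : dtm Any t -> dtm Any u ->
  dfn Any (fun e => sat a (scons (t e) (env (u e)))).
Proof.
  apply (dfn_app2 (fun x u => sat a (scons x (env u)))).
  apply dfn_ext with (fun e => sat a (fun i =>
    (match i with 0 => fun e => e 0 | S i => fun e => env (e 1) i end) e)).
  - intro e; apply sat_ext; intros [|i]; reflexivity.
  - apply dfn_sat; intros [|i]; [apply dtm_var|apply dtm_env, dtm_var].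
Qed.
Hint Resolve dfn_sat_env : dfn.

Lemma dfn_true : dfn Any (fun _ : nat -> V => True).
Proof. apply dfn_ext with (fun _ => ~ False); [tauto|dfn_tac]. Qed.

(** [R a b] says that V_b contains witnesses for the failure of the universal
    subformulas of [phi] at all parameters in V_a. *)
Lemma reflecting_relation (phi : form) : exists R : V -> V -> Prop,
  dfn Any (fun e => R (e 0) (e 1)) /\
  (forall a b c d, is_ordinal b -> is_ordinal c -> is_ordinal d ->
    R b c -> ord_le a b -> ord_le c d -> R a d) /\
  (forall a, is_ordinal a -> exists b, is_ordinal b /\ R a b) /\
  forall l, is_limit l -> (forall a, a ∈ l -> exists b, b ∈ l /\ R a b) ->
    forall e : nat -> sub (fun x => x ∈ Vr l), sat phi e <-> sat phi (fun i => incl (e i)).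
Proof.
  induction phi as [i j|i j| |f IHf g IHg|f IHf].
  - exists (fun _ _ => True); splits; [apply dfn_true|auto|intros a Oa; exists a; auto|].
    intros; simpl; tauto.
  - exists (fun _ _ => True); splits; [apply dfn_true|auto|intros a Oa; exists a; auto|].
    intros l _ _ e; simpl; split; [congruence|].
      unfold incl; destruct (e i) as [x Hx], (e j) as [y Hy]; simpl; intros <-.
      f_equal; apply proof_irrelevance.
  - exists (fun _ _ => True); splits; [apply dfn_true|auto|intros a Oa; exists a; auto|].
    intros; simpl; tauto.
  - destruct IHf as (R1 & D1 & M1 & E1 & H1), IHg as (R2 & D2 & M2 & E2 & H2).
    exists (fun a b => R1 a b /\ R2 a b); splits.
    + dfn_tac.
    + intros a b c d Ob Oc Od [G1 G2] Hab Hcd; split; [apply (M1 a b c d)|apply (M2 a b c d)]; auto.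
    + intros a Oa; destruct (E1 a Oa) as (b & Ob & Hb), (E2 a Oa) as (c & Oc & Hc).
      destruct (ord_ub2 b c) as (d & _ & Od & Hbd & Hcd); auto.
      exists d; splits; auto; [apply (M1 a a b d)|apply (M2 a a c d)]; auto using ord_le_refl.
    + intros l Ll Hl e; simpl; rewrite H1, H2; auto; [tauto| |];
        intros a Ha; destruct (Hl a Ha) as (b & Hb & G); exists b; tauto.
  - destruct IHf as (R & D & M & E & H).
    assert (D1 : forall t u : (nat -> V) -> V, dtm Any t -> dtm Any u -> dfn Any (fun e => R (t e) (u e)))
      by (apply dfn_app2; exact D).
    pose (T := fun u b => (exists x, ~ sat f (scons x (env u))) ->
      exists x, x ∈ Vr b /\ ~ sat f (scons x (env u))).
    assert (DT : forall t u : (nat -> V) -> V, dtm Any t -> dtm Any u -> dfn Any (fun e => T (t e) (u e)))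
      by (apply dfn_app2; unfold T; dfn_tac).
    assert (MT : forall u b c, is_ordinal b -> is_ordinal c -> ord_le b c -> T u b -> T u c).
    { intros u b c Ob Oc Hbc HT Hu; destruct (HT Hu) as (x & Hx & Nx); exists x.
      split; auto; apply (Vr_mono b c); auto. }
    exists (fun a b => R a b /\ forall u, u ∈ Vr a -> T u b); splits.
    + dfn_tac.
    + intros a b c d Ob Oc Od [G1 G2] Hab Hcd; split; [apply (M a b c d); auto|].
      intros u Hu; apply (MT u c d); auto; apply G2, (Vr_mono a b); auto.
      destruct Hab as [Hab| ->]; auto; apply (ord_elem b); auto.
    + intros a Oa; destruct (E a Oa) as (b & Ob & Hb).
      destruct (bounding T (Vr a)) as (g & Og & Hg).
      { dfn_tac. }
      { intros u _; destruct (classic (exists x, ~ sat f (scons x (env u)))) as [[x Nx]|N].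
        - destruct (Vr_exists x) as (c & Oc & Hx); exists c; split; auto.
          intros _; exists x; auto.
        - exists empty; split; [apply ord_empty|intro; tauto]. }
      destruct (ord_ub2 b g) as (d & _ & Od & Hbd & Hgd); auto.
      exists d; splits; auto; [apply (M a a b d); auto using ord_le_refl|].
      intros u Hu; destruct (Hg u Hu) as (c & Hcg & Oc & Hc).
      apply (MT u c d); auto; eapply le_trans; eauto.
    + intros l Ll Hl e; pose proof (proj1 Ll) as Ol.
      assert (HR : forall a, a ∈ l -> exists b, b ∈ l /\ R a b).
      { intros a Ha; destruct (Hl a Ha) as (b & Hb & G); exists b; tauto. }
      assert (K : forall x : sub (fun x => x ∈ Vr l),
        sat f (scons x e) <-> sat f (scons (incl x) (fun i => incl (e i)))).
      { intro x; rewrite (H l Ll HR); apply sat_ext; intros [|i]; reflexivity. }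
      simpl; split; intros G.
      2:{ intro x; apply K, G. }
      intro x; apply NNPP; intro N.
      (* Only finitely many entries matter, so the environment can be traded for one tuple, which
         lies in V_d for some d < l because l is a limit. *)
      assert (A : forall x, sat f (scons x (fun i => incl (e i))) <->
          sat f (scons x (env (tup (fun i => incl (e i)) (fv_bound f))))).
      { intro y; apply sat_agree; intros [|i] Hi; simpl; auto.
        symmetry; apply (env_tup (fv_bound f)); lia. }
      assert (Hu : tup (fun i => incl (e i)) (fv_bound f) ∈ Vr l).
      { apply tup_Vr; auto; intro i; exact (proj2_sig (e i)). }
      apply in_Vr_limit in Hu as (d & Hd & Hu); auto.
      destruct (Hl d Hd) as (b & Hb & _ & HT).
      destruct (HT _ Hu) as (y & Hy & Ny); [exists x; rewrite <- A; exact N|].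
      assert (Hyl : y ∈ Vr l).
      { apply (Vr_mono b l); auto using ord_lt_le; apply (ord_elem l); auto. }
      apply Ny, A, (K (exist _ y Hyl)), G.
Qed.

Lemma ord_omega_bounded (F : V -> V) : dtm_any F ->
  (forall n, n ∈ omega -> is_ordinal (F n)) ->
  exists b, is_ordinal b /\ forall n, n ∈ omega -> F n ∈ b.
Proof.
  intros HF H.
  assert (O : forall y, y ∈ image F omega -> is_ordinal y).
  { intros y Hy; apply in_image in Hy as (n & Hn & ->); auto. }
  exists (succ (bigcup (image F omega))); split; [apply ord_succ, ord_bigcup, O|].
  intros n Hn; apply lt_succ, le_bigcup; auto; apply in_image; eauto.
Qed.

Lemma reflection (phi : form) a : is_ordinal a -> exists l, is_limit l /\ a ∈ l /\
  forall e : nat -> sub (fun x => x ∈ Vr l), sat phi e <-> sat phi (fun i => incl (e i)).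
Proof.
  intro Oa; destruct (reflecting_relation phi) as (R & D & M & E & H).
  destruct (closing is_ordinal R) with (a := a) as (l & Ol & Hal & Ll & Hl & _); auto.
  - dfn_tac.
  - apply ord_elem.
  - apply ord_omega_bounded.
  - intros x Ox; destruct (E x Ox) as (b & Ob & Hb).
    destruct (ord_ub2 b (succ x)) as (c & _ & Oc & Hbc & Hxc); auto using ord_succ.
    exists c; splits; auto.
    + apply (lt_le_trans x (succ x) c); auto; apply lt_succ_diag.
    + apply (M x x b c); auto using ord_le_refl.
  - exists l; splits; auto; apply H; auto; intros x Hx.
    destruct (Hl x Hx) as (z & y & Hxz & Hzy & Hy & HR); exists y; split; auto.
    assert (Oy : is_ordinal y) by (apply (ord_elem l); auto).
    apply (M x z y y); auto using ord_le_refl; apply (ord_elem y); auto.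
Qed.

Definition Ords : pclass V := PClass V is_ordinal (ex_intro _ empty ord_empty).

Lemma list_sub (P : V -> Prop) (ps : nat -> V) m : (forall i, i < m -> P (ps i)) ->
  exists l : list (sub P), map (@incl V P) l = map ps (seq 0 m).
Proof.
  induction m as [|m IH]; intro H; [exists nil; reflexivity|].
  destruct IH as [l Hl]; [auto|].
  exists (l ++ cons (exist _ (ps m) (H m (Nat.lt_succ_diag_r m))) nil).
  rewrite seq_S, !map_app, Hl; reflexivity.
Qed.

(** Definability over V becomes definability over some V_l that reflects the formula and contains
    [A] and the constants that occur. *)
Lemma OD_of_dfn (P : V -> Prop) A : dfn Ords (fun e => P (e 0)) ->
  (forall z, z ∈ A <-> P z) -> OD A.
Proof.
  intros (phi & n & ps & Hps & E) HA.
  pose (m := fv_bound phi).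
  assert (exists a, is_ordinal a /\ A ∈ Vr a /\ forall i, i < m -> ps i ∈ Vr a)
    as (a & Oa & HAa & Hpa).
  { clearbody m; clear E phi; induction m as [|m (a & Oa & HAa & Hpa)].
    - destruct (Vr_exists A) as (a & Oa & HAa); exists a; splits; auto; lia.
    - destruct (Vr_exists (ps m)) as (b & Ob & Hb).
      destruct (ord_ub2 a b) as (c & _ & Oc & Hac & Hbc); auto.
      exists c; splits; auto; [apply (Vr_mono a c); auto|].
      intros i Hi; destruct (Nat.eq_dec i m) as [->|]; [apply (Vr_mono b c); auto|].
      apply (Vr_mono a c); auto; apply Hpa; lia. }
  (* This renaming matches the convention of [OD]: index 0 for the element, index i + 1 for the i-th
     parameter. *)
  pose (r := fun i => if i <? n then 0 else S (i - n)).
  destruct (reflection (ren r phi) a Oa) as (l & Ll & Hal & Hl).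
  pose proof (proj1 Ll) as Ol.
  assert (S : subset (Vr a) (Vr l)) by (apply Vr_mono; auto using ord_lt_le).
  destruct (list_sub (fun x => x ∈ Vr l) ps m) as [params Hpar]; [auto|].
  assert (Len : length params = m).
  { rewrite <- (length_map (@incl V (fun x => x ∈ Vr l)) params), Hpar, length_map, length_seq; auto. }
  exists l, (Vr l), (ren r phi), params; splits; auto.
  - apply is_rank_level_iff; auto.
  - intros q Hq; apply (in_map (@incl V (fun x => x ∈ Vr l))) in Hq; rewrite Hpar in Hq.
    apply in_map_iff in Hq as (i & <- & _); apply Hps.
  - assert (K : forall z : sub (fun x => x ∈ Vr l),
      sat (ren r phi) (fun i => nth i (z :: params) z) <-> P (incl z)).
    { intro z; rewrite Hl, sat_ren, (E (fun _ => incl z)); apply sat_agree.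
      intros i Hi; unfold r; ltb; simpl; [reflexivity|].
      transitivity (nth (i - n) (map (@incl V (fun x => x ∈ Vr l)) params) (incl z)).
      { symmetry; exact (map_nth (@incl V (fun x => x ∈ Vr l)) params z (i - n)). }
      rewrite Hpar.
      rewrite (nth_indep _ _ (ps 0)), map_nth, seq_nth; [reflexivity| |];
        try rewrite length_map, length_seq; unfold m; lia. }
    intro y; rewrite HA; split.
    + intro Hy.
      assert (Hyl : y ∈ Vr l) by (apply (Vr_trans l y A); auto; apply HA, Hy).
      exists (exist _ y Hyl); split; [reflexivity|]; apply K; exact Hy.
    + intros (z & <- & Hz); apply K; exact Hz.
Qed.

End Reflection.
#[export] Hint Resolve dtm_env : dfn.

(** * An ordinal-indexed enumeration of the ordinal definable sets *)

Section Enumeration.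
Context {V : estruct} {zfcV : ZFC V}.
Implicit Types x y z a b c i m n s p f u l T : V.

Lemma dfn_is_limit Q (t : (nat -> V) -> V) : dtm Q t -> dfn Q (fun e => is_limit (t e)).
Proof. apply (dfn_app1 (fun x e => is_limit x)); unfold is_limit; dfn_tac. Qed.
Hint Resolve dfn_is_limit : dfn.

(** At a limit l, V_l is closed under pairs and so contains the codes of environments over V_b. *)
Definition lim_above b := least (fun l => is_limit l /\ b ∈ l).

Lemma dtm_lim_above Q (t : (nat -> V) -> V) : dtm Q t -> dtm Q (fun e => lim_above (t e)).
Proof. apply dtm_app1; unfold lim_above; dfn_tac. Qed.
Hint Resolve dtm_lim_above : dfn.

Lemma lim_above_spec b : is_ordinal b -> is_limit (lim_above b) /\ b ∈ lim_above b.
Proof.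
  intro Ob; destruct (least_spec (fun l => is_limit l /\ b ∈ l)) as (_ & H & _); [dfn_tac| |exact H].
  (* Reflecting a trivial formula provides a limit above b. *)
  destruct (reflection fBot b Ob) as (l & Ll & Hl & _); exists l; split; auto; apply Ll.
Qed.

Fixpoint num (k : nat) : V := match k with 0 => empty | S k => succ (num k) end.

Lemma num_omega (k : nat) : num k ∈ omega.
Proof. induction k; simpl; auto using zero_in_omega, succ_in_omega. Qed.

Lemma ord_nat n : n ∈ omega -> is_ordinal n.
Proof. apply ord_elem, ord_omega. Qed.

Lemma num_ord (k : nat) : is_ordinal (num k).
Proof. apply ord_nat, num_omega. Qed.

Lemma dtm_num Q (k : nat) : dtm Q (fun _ => num k).
Proof. induction k; simpl; dfn_tac. Qed.
Hint Resolve dtm_num : dfn.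

Lemma num_inj (j k : nat) : num j = num k -> j = k.
Proof.
  assert (N : forall a, empty <> succ a).
  { intros a H; apply (in_empty a); rewrite H; apply lt_succ_diag. }
  revert k; induction j as [|j IH]; intros [|k]; simpl; auto.
  - intro H; destruct (N _ H).
  - intro H; symmetry in H; destruct (N _ H).
  - intro H; f_equal; apply IH, succ_inj, H.
Qed.

(** Here the index is a set of V, as a single formula for all steps requires; at numerals it agrees
    with [env], whose index belongs to the metatheory. *)
Definition proj a u := fst (iter snd u a).

Lemma proj_num (k : nat) u : proj (num k) u = env u k.
Proof.
  destruct (iter_eq snd u) as [H0 HS]; [dfn_tac|].
  unfold proj, env; f_equal.
  assert (D : forall k u, drop (S k) u = snd (drop k u)).
  { clear; induction k as [|k IH]; intro u; [reflexivity|apply (IH (snd u))]. }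
  induction k as [|k IH]; [exact H0|].
  rewrite D; change (num (S k)) with (succ (num k)).
  rewrite HS by apply num_omega; f_equal; exact IH.
Qed.

Lemma dtm_proj Q (t u : (nat -> V) -> V) : dtm Q t -> dtm Q u -> dtm Q (fun e => proj (t e) (u e)).
Proof. intros Ht Hu; apply dtm_fst, dtm_iter; dfn_tac. Qed.
Hint Resolve dtm_proj : dfn.

(** The sets obtained by one step of the inductive definition of truth in V_b,
    from the indices [a], [c] and the sets [x], [y] enumerated at these indices. *)
Definition truth_step b i a c x y u :=
  (i = num 0 /\ proj a u ∈ proj c u) \/
  (i = num 1 /\ proj a u = proj c u) \/
  (i = num 2 /\ proj a u = c) \/
  (i = num 3 /\ (u ∈ x -> u ∈ y)) \/
  (i = num 4 /\ forall v, v ∈ Vr b -> opair v u ∈ x).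

Definition truth_set b i a c x y :=
  setof (fun u => u ∈ Vr (lim_above b) /\ truth_step b i a c x y u).

Lemma in_truth_set b i a c x y u :
  u ∈ truth_set b i a c x y <-> u ∈ Vr (lim_above b) /\ truth_step b i a c x y u.
Proof. apply in_sep; unfold truth_step; dfn_tac. Qed.

(** Minimality of a triple of ordinals: first the maximum, then lexicographically. *)
Definition least_triple (P : V -> V -> V -> Prop) i a c :=
  P i a c /\ exists m, is_ordinal m /\ (ord_le i m /\ ord_le a m /\ ord_le c m) /\
    forall i' a' c', P i' a' c' ->
      (ord_le m i' \/ ord_le m a' \/ ord_le m c') /\
      (ord_le i' m -> ord_le a' m -> ord_le c' m ->
        ord_le i i' /\ (i = i' -> ord_le a a' /\ (a = a' -> ord_le c c'))).

Lemma least_triple_exists (P : V -> V -> V -> Prop) :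
  dfn Any (fun e => P (e 0) (e 1) (e 2)) ->
  (forall i a c, P i a c -> is_ordinal i /\ is_ordinal a /\ is_ordinal c) ->
  (exists i a c, P i a c) -> exists i a c, least_triple P i a c.
Proof.
  intros HP HO (i0 & a0 & c0 & P0).
  assert (D : forall t u v : (nat -> V) -> V, dtm Any t -> dtm Any u -> dtm Any v ->
    dfn Any (fun e => P (t e) (u e) (v e))) by (apply dfn_app3; exact HP).
  pose (B := fun m i a c => P i a c /\ ord_le i m /\ ord_le a m /\ ord_le c m).
  destruct (HO _ _ _ P0) as (Oi0 & Oa0 & Oc0).
  destruct (ord_ub2 i0 a0) as (m1 & _ & Om1 & H1 & H2); auto.
  destruct (ord_ub2 m1 c0) as (m0 & _ & Om0 & H3 & H4); auto.
  destruct (least_exists (fun m => exists i a c, B m i a c) m0)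
    as (m & Om & (i1 & a1 & c1 & B1) & Hm & _).
  { unfold B; dfn_tac. } { auto. }
  { exists i0, a0, c0; unfold B; splits; auto; eapply le_trans; eauto. }
  destruct (least_exists (fun i => exists a c, B m i a c) i1)
    as (i & Oi & (a2 & c2 & B2) & Hi & _).
  { unfold B; dfn_tac. } { apply (HO _ _ _ (proj1 B1)). } { eauto. }
  destruct (least_exists (fun a => exists c, B m i a c) a2)
    as (a & Oa & (c3 & B3) & Ha & _).
  { unfold B; dfn_tac. } { apply (HO _ _ _ (proj1 B2)). } { eauto. }
  destruct (least_exists (fun c => B m i a c) c3) as (c & Oc & B4 & Hc & _).
  { unfold B; dfn_tac. } { apply (HO _ _ _ (proj1 B3)). } { exact B3. }
  exists i, a, c; split; [apply B4|]; exists m; split; [exact Om|]; split; [apply B4|].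
  intros i' a' c' P'; destruct (HO _ _ _ P') as (Oi' & Oa' & Oc'); split.
  - destruct (ord_le_or_lt m i') as [|L1]; auto.
    destruct (ord_le_or_lt m a') as [|L2]; auto.
    destruct (ord_le_or_lt m c') as [|L3]; auto.
    destruct (ord_ub2 i' a') as (k1 & E1 & Ok1 & G1 & G2); auto.
    destruct (ord_ub2 k1 c') as (k & E & Ok & G3 & G4); auto.
    destruct (Hm k).
    + destruct E as [-> | ->]; auto; destruct E1 as [-> | ->]; auto.
    + exists i', a', c'; unfold B; splits; auto; eapply le_trans; eauto.
  - intros L1 L2 L3; split; [|intros <-; split; [|intros <-]].
    + destruct (ord_le_or_lt i i') as [|L]; auto; destruct (Hi i' L).
      exists a', c'; unfold B; auto.
    + destruct (ord_le_or_lt a a') as [|L]; auto; destruct (Ha a' L).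
      exists c'; unfold B; auto.
    + destruct (ord_le_or_lt c c') as [|L]; auto; destruct (Hc c' L).
      unfold B; auto.
Qed.

Lemma least_triple_unique (P : V -> V -> V -> Prop) i a c i' a' c' :
  least_triple P i a c -> least_triple P i' a' c' -> i = i' /\ a = a' /\ c = c'.
Proof.
  intros (Pt & m & Om & (Hi & Ha & Hc) & H) (Pt' & m' & Om' & (Hi' & Ha' & Hc') & H').
  destruct (H _ _ _ Pt') as [K L], (H' _ _ _ Pt) as [K' L'].
  assert (E : m = m').
  { apply le_antisym.
    - destruct K as [K|[K|K]]; eapply le_trans; eauto.
    - destruct K' as [K'|[K'|K']]; eapply le_trans; eauto. }
  subst m'; destruct (L Hi' Ha' Hc') as [L1 L2], (L' Hi Ha Hc) as [L1' L2'].
  assert (i = i') as <- by (apply le_antisym; auto).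
  destruct (L2 eq_refl) as [L3 L4], (L2' eq_refl) as [L3' L4'].
  assert (a = a') as <- by (apply le_antisym; auto).
  splits; auto; apply le_antisym; auto.
Qed.

(** This is why maxima are compared first: the triples with entries below m form an initial
    segment. *)
Lemma least_triple_lt (P : V -> V -> V -> Prop) i a c i' a' c' m :
  least_triple P i a c -> P i' a' c' -> is_ordinal m -> i' ∈ m -> a' ∈ m -> c' ∈ m ->
  i ∈ m /\ a ∈ m /\ c ∈ m.
Proof.
  intros (Pt & k & Ok & (Hi & Ha & Hc) & H) P' Om Mi Ma Mc.
  assert (k ∈ m).
  { destruct (H _ _ _ P') as [[K|[K|K]] _]; eapply le_lt_trans; eauto. }
  splits; eapply le_lt_trans; eauto.
Qed.

(** With s the enumeration so far, having a value under s means being an earlier index. *)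
Definition fresh b s i a c :=
  (exists y, maps s i y) /\ (exists y, maps s a y) /\ (exists y, maps s c y) /\
  is_ordinal i /\ is_ordinal a /\ is_ordinal c /\
  forall j y, maps s j y -> y <> truth_set b i a c (app s a) (app s c).

(** When no triple is fresh, as at stage 0, the value is the empty set by default. *)
Definition enum_step b s := iota (fun x => exists i a c,
  least_triple (fresh b s) i a c /\ x = truth_set b i a c (app s a) (app s c)).

(** Enumerates a family of subsets of V_l, where l is the least limit above b,
    that is closed under [truth_set]; [enum b] at an ordinal is the value at the
    least triple of smaller indices that is not yet enumerated. *)
Definition enum b a := rec enum_step b a.

Lemma dtm_enum_step Q (t u : (nat -> V) -> V) : dtm Q t -> dtm Q u -> dtm Q (fun e => enum_step (t e) (u e)).
Proof.
  apply dtm_app2; unfold enum_step, least_triple, fresh, truth_set, truth_step; dfn_tac.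
Qed.
Hint Resolve dtm_enum_step : dfn.

Lemma dtm_enum Q (t u : (nat -> V) -> V) : dtm Q t -> dtm Q u -> dtm Q (fun e => enum (t e) (u e)).
Proof. intros Ht Hu; unfold enum; apply dtm_rec; dfn_tac. Qed.
Hint Resolve dtm_enum : dfn.

Lemma enum_eq b a : is_ordinal a -> enum b a = enum_step b (graph (enum b) a).
Proof.
  intro Oa; destruct (rec_eq enum_step b) as [_ H]; [dfn_tac|exact (H a Oa)].
Qed.

Lemma bounding_upward (R : V -> V -> Prop) a : dfn Any (fun e => R (e 0) (e 1)) ->
  (forall x b c, is_ordinal c -> R x b -> ord_le b c -> R x c) ->
  (forall x, x ∈ a -> exists b, is_ordinal b /\ R x b) ->
  exists g, is_ordinal g /\ forall x, x ∈ a -> R x g.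
Proof.
  intros HR U H; destruct (bounding R a HR H) as (g & Og & Hg).
  exists g; split; auto; intros x Hx; destruct (Hg x Hx) as (b & Hb & _ & HRb); eauto.
Qed.

(** Otherwise a triple below a fixed bound is picked at every large index, and no
    triple is picked twice. *)
Lemma enum_closed b i a c : is_ordinal i -> is_ordinal a -> is_ordinal c ->
  exists k, is_ordinal k /\ enum b k = truth_set b i a c (enum b a) (enum b c).
Proof.
  intros Oi Oa Oc; apply NNPP; intro N.
  assert (DE : dtm_any (enum b)) by dfn_tac.
  assert (App : forall k a, a ∈ k -> app (graph (enum b) k) a = enum b a).
  { intros k a' Ha; apply app_eq; [apply maps_graph; auto|].
    intros z Hz; apply maps_graph in Hz; tauto. }
  assert (Dfresh : forall k i a c : (nat -> V) -> V, dtm Any k -> dtm Any i -> dtm Any a ->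
    dtm Any c -> dfn Any (fun e => fresh b (graph (enum b) (k e)) (i e) (a e) (c e))).
  { apply (dfn_app4 (fun k i a c => fresh b (graph (enum b) k) i a c)).
    unfold fresh, truth_set, truth_step; dfn_tac. }
  pose (pick := fun k i a c => least_triple (fresh b (graph (enum b) k)) i a c).
  assert (Dpick : forall k i a c : (nat -> V) -> V, dtm Any k -> dtm Any i -> dtm Any a ->
    dtm Any c -> dfn Any (fun e => pick (k e) (i e) (a e) (c e))).
  { apply dfn_app4; unfold pick, least_triple; dfn_tac. }
  assert (Pval : forall k i a c, is_ordinal k -> pick k i a c ->
    i ∈ k /\ a ∈ k /\ c ∈ k /\ enum b k = truth_set b i a c (enum b a) (enum b c) /\
    forall j, j ∈ k -> enum b j <> truth_set b i a c (enum b a) (enum b c)).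
  { intros k i' a' c' Ok Hp; pose proof Hp as [((y1 & M1) & (y2 & M2) & (y3 & M3) & _ & _ & _ & F) _].
    apply maps_graph in M1 as [M1 _], M2 as [M2 _], M3 as [M3 _]; auto.
    rewrite !App in F by assumption.
    splits; auto.
    - rewrite enum_eq by assumption; apply iota_eq.
      + exists i', a', c'; rewrite !App by assumption; auto.
      + intros y (i2 & a2 & c2 & Ht & ->).
        destruct (least_triple_unique _ _ _ _ _ _ _ Hp Ht) as (<- & <- & <-).
        rewrite !App by assumption; reflexivity.
    - intros j Hj; apply (F j); apply maps_graph; auto. }
  assert (Pinj : forall k k' i a c, is_ordinal k -> is_ordinal k' ->
    pick k i a c -> pick k' i a c -> k = k').
  { intros k k' i' a' c' Ok Ok' Hp Hp'.
    destruct (Pval _ _ _ _ Ok Hp) as (_ & _ & _ & E & F).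
    destruct (Pval _ _ _ _ Ok' Hp') as (_ & _ & _ & E' & F').
    destruct (ord_trichotomy k k') as [H|[H|H]]; auto; exfalso.
    - apply (F' k H E).
    - apply (F k' H E'). }
  destruct (ord_ub2 i a) as (m1 & _ & Om1 & L1 & L2); auto.
  destruct (ord_ub2 m1 c) as (m2 & _ & Om2 & L3 & L4); auto.
  pose (m := succ m2); assert (Om : is_ordinal m) by (apply ord_succ; auto).
  assert (Him : i ∈ m) by (apply lt_succ; eapply le_trans; eauto).
  assert (Ham : a ∈ m) by (apply lt_succ; eapply le_trans; eauto).
  assert (Hcm : c ∈ m) by (apply lt_succ; auto).
  (* By assumption [N] the given triple stays fresh at every stage from m on, and it bounds the
     triple picked there. *)
  assert (Pex : forall k, is_ordinal k -> ord_le m k ->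
    exists i a c, i ∈ m /\ a ∈ m /\ c ∈ m /\ pick k i a c).
  { intros k Ok Hk.
    assert (Fk : fresh b (graph (enum b) k) i a c).
    { assert (S : forall x, x ∈ m -> x ∈ k) by (apply le_subset; auto).
      unfold fresh; splits; auto; try (eexists; apply maps_graph; auto; fail).
      intros j y Hy E; apply maps_graph in Hy as [Hj ->]; auto.
      rewrite !App in E by auto; apply N; exists j; split; [apply (ord_elem k)|]; auto. }
    destruct (least_triple_exists (fresh b (graph (enum b) k))) as (i' & a' & c' & Hp).
    - dfn_tac.
    - unfold fresh; tauto.
    - eauto.
    - destruct (least_triple_lt _ _ _ _ _ _ _ m Hp Fk) as (H1 & H2 & H3); auto.
      exists i', a', c'; auto. }
  (* Each triple is picked at most once, so collection, one coordinate at a time, bounds all stages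
     at which triples below m are picked. *)
  assert (Pbound : exists g, is_ordinal g /\ forall i, i ∈ m -> forall a, a ∈ m ->
    forall c, c ∈ m -> forall k, is_ordinal k -> pick k i a c -> k ∈ g).
  { apply (bounding_upward (fun i g => forall a, a ∈ m -> forall c, c ∈ m ->
      forall k, is_ordinal k -> pick k i a c -> k ∈ g)); [dfn_tac| |].
    { intros; eapply lt_le_trans; eauto. }
    intros i' Hi'; apply (bounding_upward (fun a g => forall c, c ∈ m ->
      forall k, is_ordinal k -> pick k i' a c -> k ∈ g)); [dfn_tac| |].
    { intros; eapply lt_le_trans; eauto. }
    intros a' Ha'; apply (bounding_upward (fun c g =>
      forall k, is_ordinal k -> pick k i' a' c -> k ∈ g)); [dfn_tac| |].
    { intros; eapply lt_le_trans; eauto. }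
    intros c' Hc'.
    destruct (classic (exists k, is_ordinal k /\ pick k i' a' c')) as [(k & Ok & Hk)|Nk].
    - exists (succ k); split; [apply ord_succ, Ok|]; intros k' Ok' Hk'.
      rewrite (Pinj k' k i' a' c'); auto; apply lt_succ_diag.
    - exists empty; split; [apply ord_empty|]; intros k Ok Hk; destruct Nk; eauto. }
  destruct Pbound as (g & Og & Hg).
  destruct (ord_ub2 m g) as (k & _ & Ok & Hmk & Hgk); auto.
  destruct (Pex k Ok Hmk) as (i' & a' & c' & Hi & Ha & Hc & Hp).
  apply (le_not_lt g k Hgk), (Hg i' Hi a' Ha c' Hc k Ok Hp).
Qed.

(** V_l is the set of codes of environments. *)
Definition coded b (P : V -> Prop) :=
  exists k, is_ordinal k /\ forall u, u ∈ enum b k <-> u ∈ Vr (lim_above b) /\ P u.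

Lemma coded_ext b (P P' : V -> Prop) :
  (forall u, u ∈ Vr (lim_above b) -> P u <-> P' u) -> coded b P -> coded b P'.
Proof.
  intros H (k & Ok & Hk); exists k; split; auto; intro u; rewrite Hk.
  split; intros [Hu Pu]; split; auto; apply (H u Hu); auto.
Qed.

Lemma coded_step b i a c : is_ordinal i -> is_ordinal a -> is_ordinal c ->
  coded b (truth_step b i a c (enum b a) (enum b c)).
Proof.
  intros Oi Oa Oc; destruct (enum_closed b i a c) as (k & Ok & E); auto.
  exists k; split; auto; intro u; rewrite E; apply in_truth_set.
Qed.

Ltac num_ne := repeat match goal with
  | H : num ?j = num ?k |- _ => apply num_inj in H; try discriminate H; clear H
  end.

Lemma coded_mem b (j k : nat) : coded b (fun u => env u j ∈ env u k).
Proof.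
  eapply coded_ext; [|apply (coded_step b (num 0) (num j) (num k)); apply num_ord].
  intros u _; unfold truth_step; rewrite !proj_num; intuition num_ne.
Qed.

Lemma coded_eq b (j k : nat) : coded b (fun u => env u j = env u k).
Proof.
  eapply coded_ext; [|apply (coded_step b (num 1) (num j) (num k)); apply num_ord].
  intros u _; unfold truth_step; rewrite !proj_num; intuition num_ne.
Qed.

(** This is where ordinal parameters enter: instruction 2 uses the index c itself and not the set
    enumerated there. *)
Lemma coded_const b (j : nat) c : is_ordinal c -> coded b (fun u => env u j = c).
Proof.
  intro Oc; eapply coded_ext; [|apply (coded_step b (num 2) (num j) c); auto; apply num_ord].
  intros u _; unfold truth_step; rewrite !proj_num; intuition num_ne.
Qed.

(** [truth_step] has no instruction 5, so its truth set is empty. *)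
Lemma coded_false b : coded b (fun _ => False).
Proof.
  eapply coded_ext; [|apply (coded_step b (num 5) (num 0) (num 0)); apply num_ord].
  intros u _; unfold truth_step; intuition num_ne.
Qed.

Lemma coded_imp b (P P' : V -> Prop) : coded b P -> coded b P' ->
  coded b (fun u => P u -> P' u).
Proof.
  intros (a & Oa & Ha) (c & Oc & Hc).
  eapply coded_ext; [|apply (coded_step b (num 3) a c); auto; apply num_ord].
  intros u Hu; unfold truth_step; rewrite Ha, Hc; intuition num_ne.
Qed.

Lemma coded_all b (P : V -> Prop) : is_ordinal b -> coded b P ->
  coded b (fun u => forall v, v ∈ Vr b -> P (opair v u)).
Proof.
  intros Ob (a & Oa & Ha); destruct (lim_above_spec b Ob) as [Ll Hl].
  assert (S : subset (Vr b) (Vr (lim_above b))).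
  { apply Vr_mono; auto using ord_lt_le; apply Ll. }
  eapply coded_ext; [|apply (coded_step b (num 4) a a); auto; apply num_ord].
  intros u Hu; unfold truth_step; split.
  - intros H v Hv; intuition num_ne; apply Ha; auto.
  - intro H; do 4 right; split; auto; intros v Hv; apply Ha; split; auto.
    apply opair_Vr; auto.
Qed.

Lemma coded_not b (P : V -> Prop) : coded b P -> coded b (fun u => ~ P u).
Proof. intro H; apply coded_imp; [exact H|apply coded_false]. Qed.

Lemma coded_and b (P P' : V -> Prop) : coded b P -> coded b P' ->
  coded b (fun u => P u /\ P' u).
Proof.
  intros H H'; apply coded_ext with (fun u => ~ (P u -> ~ P' u)); [intros; tauto|].
  apply coded_not, coded_imp; auto using coded_not.
Qed.

(** Truth in the structure [x], with the environment in the universe. *)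
Fixpoint satr x (phi : form) (e : nat -> V) : Prop :=
  match phi with
  | fMem i j => e i ∈ e j
  | fEq i j => e i = e j
  | fBot => False
  | fImp f g => satr x f e -> satr x g e
  | fAll f => forall y, y ∈ x -> satr x f (scons y e)
  end.

Lemma satr_agree x (phi : form) : forall e e' : nat -> V,
  (forall i : nat, (i < fv_bound phi)%nat -> e i = e' i) -> satr x phi e <-> satr x phi e'.
Proof.
  induction phi as [i j|i j| |f IHf g IHg|f IHf]; simpl; intros e e' H.
  - rewrite (H i), (H j) by lia; tauto.
  - rewrite (H i), (H j) by lia; tauto.
  - tauto.
  - rewrite (IHf e e'), (IHg e e'); [tauto| |]; intros; apply H; lia.
  - assert (E : forall y, satr x f (scons y e) <-> satr x f (scons y e')).
    { intro y; apply IHf; intros [|i] Hi; simpl; [reflexivity|apply H; lia]. }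
    split; intros G y Hy; apply E, G, Hy.
Qed.

Lemma satr_ext x (phi : form) (e e' : nat -> V) : (forall i : nat, e i = e' i) ->
  satr x phi e <-> satr x phi e'.
Proof. intro H; apply satr_agree; auto. Qed.

Lemma sat_sub x (phi : form) : forall e : nat -> sub (fun y => y ∈ x),
  sat phi e <-> satr x phi (fun i : nat => incl (e i)).
Proof.
  induction phi as [i j|i j| |f IHf g IHg|f IHf]; simpl; intros e.
  - tauto.
  - split; [congruence|].
    unfold incl; destruct (e i) as [y Hy], (e j) as [z Hz]; simpl; intros <-.
    f_equal; apply proof_irrelevance.
  - tauto.
  - rewrite IHf, IHg; tauto.
  - split.
    + intros H y Hy; specialize (H (exist _ y Hy)); rewrite IHf in H.
      eapply satr_ext; [|exact H]; intros [|i]; reflexivity.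
    + intros H [y Hy]; rewrite IHf.
      eapply satr_ext; [|exact (H y Hy)]; intros [|i]; reflexivity.
Qed.

Lemma coded_satr b (phi : form) : is_ordinal b -> coded b (fun u => satr (Vr b) phi (env u)).
Proof.
  intro Ob; induction phi as [i j|i j| |f IHf g IHg|f IHf]; simpl.
  - apply coded_mem.
  - apply coded_eq.
  - apply coded_false.
  - apply coded_imp; auto.
  - apply coded_ext with (fun u => forall v, v ∈ Vr b -> satr (Vr b) f (env (opair v u))).
    + intros u _.
      assert (E : forall v, satr (Vr b) f (env (opair v u)) <-> satr (Vr b) f (scons v (env u))).
      { intro v; apply satr_ext, env_cons. }
      split; intros H v Hv; apply E, H, Hv.
    + apply (coded_all b (fun u => satr (Vr b) f (env u))); auto.
Qed.

(** A set defined over V_b is the projection to entry 0 of the set of environments that satisfy the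
    formula and carry the right parameters. *)
Definition od_val b k := image fst (enum b k).

Lemma dtm_od_val Q (t u : (nat -> V) -> V) : dtm Q t -> dtm Q u ->
  dtm Q (fun e => od_val (t e) (u e)).
Proof. apply dtm_app2; unfold od_val; dfn_tac. Qed.

(** The coded set consists of the u whose entry 0 lies in V_b ([D]), whose further entries are those
    prescribed by [OD] ([C]), and which satisfy [phi] in V_b. *)
Lemma OD_od_val A : OD A ->
  exists b k, is_ordinal b /\ is_ordinal k /\ A = od_val b k.
Proof.
  intros (b & X & phi & params & Ob & HX & Hpar & HA).
  apply is_rank_level_iff in HX; auto; subst X.
  destruct (lim_above_spec b Ob) as [Ll Hl].
  assert (HS : subset (Vr b) (Vr (lim_above b))).
  { apply Vr_mono; auto using ord_lt_le; apply Ll. }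
  pose (q := fun (z : sub (fun x => x ∈ Vr b)) (i : nat) => nth i (z :: params) z).
  assert (HA' : forall y, y ∈ A <-> exists z : sub (fun x => x ∈ Vr b),
    incl z = y /\ satr (Vr b) phi (fun i : nat => incl (q z i))).
  { intro y; rewrite HA; split; intros (z & Hz & H); exists z; split; auto;
      apply sat_sub; exact H. }
  pose (C := fun (m : nat) u => forall z : sub (fun x => x ∈ Vr b), incl z = env u 0 ->
    forall i : nat, (i < m)%nat -> env u i = incl (q z i)).
  pose (D := fun u => env u 0 ∈ Vr b).
  assert (HD : coded b D).
  (* A bounded existential statement: prefixing v moves entry 0 of u to index 1. *)
  { apply coded_ext with (fun u => ~ forall v, v ∈ Vr b -> ~ env (opair v u) 0 = env (opair v u) 1).
    - intros u _; unfold D; split.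
      + intro H; apply NNPP; intro N; apply H; intros v Hv; rewrite !env_cons; simpl.
        intros ->; auto.
      + intros H K; apply (K _ H); rewrite !env_cons; reflexivity.
    - apply coded_not, (coded_all b (fun w => ~ env w 0 = env w 1)); auto.
      apply coded_not, coded_eq. }
  assert (HC : forall m : nat, coded b (fun u => D u /\ C m u)).
  { induction m as [|m IH].
    { apply coded_ext with D; auto; intros u _; unfold C; split; [|tauto].
      intro; split; auto; intros; lia. }
    (* The condition on entry m alone: void for m = 0, a constant at a parameter, and equality with
       entry 0 beyond the list. *)
    assert (exists P, coded b P /\ forall u, D u -> (P u <->
      forall z : sub (fun x => x ∈ Vr b), incl z = env u 0 -> env u m = incl (q z m)))
      as (P & HP & EP).
    { destruct m as [|m].
      - exists (fun u => env u 0 = env u 0); split; [apply coded_eq|].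
        intros u _; split; auto.
      - destruct (Nat.lt_ge_cases m (length params)) as [Hm|Hm].
        + destruct (nth_error params m) as [p|] eqn:Ep.
          2:{ apply nth_error_None in Ep; lia. }
          assert (Eq : forall z : sub (fun x => x ∈ Vr b), q z (S m) = p).
          { intro z; unfold q; simpl; apply nth_error_nth; exact Ep. }
          exists (fun u => env u (S m) = incl p); split.
          * apply coded_const, Hpar; eapply nth_error_In; eauto.
          * intros u Du; split; [intros -> z _; rewrite Eq; auto|].
            intro H; rewrite (H (exist _ (env u 0) Du) eq_refl), Eq; reflexivity.
        + assert (Eq : forall z : sub (fun x => x ∈ Vr b), q z (S m) = z).
          { intro z; unfold q; simpl; apply nth_overflow; exact Hm. }
          exists (fun u => env u (S m) = env u 0); split; [apply coded_eq|].
          intros u Du; split; [intros -> z Hz; rewrite Eq; auto|].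
          intro H; rewrite (H (exist _ (env u 0) Du) eq_refl), Eq; reflexivity. }
    apply coded_ext with (fun u => (D u /\ C m u) /\ P u); [|apply coded_and; auto].
    intros u _; split.
    - intros [[Du Cu] Pu]; split; auto; intros z Hz i Hi.
      destruct (Nat.eq_dec i m) as [->|]; [apply (EP u Du); auto|apply Cu; auto; lia].
    - intros [Du Cu]; split; [split; auto; intros z Hz i Hi; apply Cu; auto; lia|].
      apply EP; auto. }
  (* The successor ensures that the tuples have an entry 0 even if [phi] has no free variable. *)
  destruct (coded_and b _ _ (HC (S (fv_bound phi))) (coded_satr b phi Ob)) as (k & Ok & Hk).
  exists b, k; splits; auto; apply ext; intro y; rewrite HA'.
  unfold od_val; rewrite in_image by dfn_tac; split.
  - intros (z & <- & Hz).
    assert (E : forall i : nat, (i < S (fv_bound phi))%nat ->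
      env (tup (fun i : nat => incl (q z i)) (S (fv_bound phi))) i = incl (q z i)).
    { exact (env_tup _ (fun i : nat => incl (q z i))). }
    exists (tup (fun i : nat => incl (q z i)) (S (fv_bound phi))).
    assert (E0 := E 0 (Nat.lt_0_succ _)).
    split; [|symmetry; exact E0].
    apply Hk; splits.
    + apply tup_Vr; auto; intro i; apply HS, (proj2_sig (q z i)).
    + split.
      * unfold D; rewrite E0; exact (proj2_sig z).
      * intros z' Hz' i Hi; rewrite E by exact Hi.
        assert (z' = z) as ->; [|reflexivity].
        rewrite E0 in Hz'; destruct z as [z0 p], z' as [z0' p']; simpl in Hz'; subst.
        f_equal; apply proof_irrelevance.
    + apply (satr_agree (Vr b) phi _ (fun i : nat => incl (q z i))); auto.
  - intros (u & Hu & ->); apply Hk in Hu as (_ & [Du Cu] & Hs).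
    exists (exist _ (env u 0) Du); split; [reflexivity|].
    apply (satr_agree (Vr b) phi (env u)); auto.
Qed.
End Enumeration.
#[export] Hint Resolve dtm_od_val : dfn.

(** * Absoluteness between a transitive class and the universe *)

Section Absoluteness.
Context {V : estruct} {M : V -> Prop} (Mtrans : forall x y : V, M x -> y ∈ x -> M y).
Notation N := (sub M).

Lemma incl_inj (x y : N) : incl x = incl y -> x = y.
Proof.
  destruct x as [x Hx], y as [y Hy]; unfold incl; simpl; intros <-.
  f_equal; apply proof_irrelevance.
Qed.

Lemma lift (z : V) (x : N) : z ∈ incl x -> exists w : N, z = incl w /\ w ∈ x.
Proof.
  intro H; exists (exist _ z (Mtrans (incl x) z (proj2_sig x) H)); split; [reflexivity|exact H].
Qed.

Lemma abs_upair (p x y : N) : is_upair p x y <-> is_upair (incl p) (incl x) (incl y).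
Proof.
  split; intros H z.
  - split.
    + intro Hz; destruct (lift z p Hz) as (w & -> & Hw).
      apply H in Hw as [-> | ->]; auto.
    + intros [-> | ->]; apply H; auto.
  - split.
    + intro Hz; apply (H (incl z)) in Hz as [Hz|Hz]; apply incl_inj in Hz; auto.
    + intros [-> | ->]; apply H; auto.
Qed.

Lemma abs_opair (p x y : N) : is_opair p x y <-> is_opair (incl p) (incl x) (incl y).
Proof.
  split.
  - intros (a & b & Ha & Hb & Hp); exists (incl a), (incl b); rewrite <- !abs_upair; auto.
  - intros (a & b & Ha & Hb & Hp).
    destruct (lift a p (proj2 (Hp a) (or_introl eq_refl))) as (a' & -> & _).
    destruct (lift b p (proj2 (Hp b) (or_intror eq_refl))) as (b' & -> & _).
    exists a', b'; rewrite !abs_upair; auto.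
Qed.

Lemma abs_maps (f x y : N) : maps f x y <-> maps (incl f) (incl x) (incl y).
Proof.
  split.
  - intros (p & Hp & H); exists (incl p); rewrite <- abs_opair; auto.
  - intros (p & Hp & H); destruct (lift p f H) as (q & -> & Hq).
    exists q; rewrite abs_opair; auto.
Qed.

Lemma lift_maps (f : N) (x y : V) : maps (incl f) x y ->
  exists x' y' : N, x = incl x' /\ y = incl y'.
Proof.
  intros (p & (a & b & Ha & Hb & Hp) & H); destruct (lift p f H) as (p' & -> & _).
  destruct (lift b p' (proj2 (Hp b) (or_intror eq_refl))) as (b' & -> & _).
  destruct (lift x b' (proj2 (Hb x) (or_introl eq_refl))) as (x' & -> & _).
  destruct (lift y b' (proj2 (Hb y) (or_intror eq_refl))) as (y' & -> & _); eauto.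
Qed.

Lemma abs_fun (f a b : N) : is_fun f a b <-> is_fun (incl f) (incl a) (incl b).
Proof.
  split; intros [H1 H2]; split.
  - intros p Hp; destruct (lift p f Hp) as (q & -> & Hq).
    destruct (H1 q Hq) as (x & y & Hx & Hy & Hxy); exists (incl x), (incl y).
    rewrite <- abs_opair; auto.
  - intros x Hx; destruct (lift x a Hx) as (x' & -> & Hx').
    destruct (H2 x' Hx') as (y & Hy & U); exists (incl y); split; [apply abs_maps, Hy|].
    intros z Hz; destruct (lift_maps _ _ _ Hz) as (_ & z' & _ & ->).
    f_equal; apply U, abs_maps, Hz.
  - intros p Hp; destruct (H1 (incl p) Hp) as (x & y & Hx & Hy & Hxy).
    destruct (lift x a Hx) as (x' & -> & Hx'), (lift y b Hy) as (y' & -> & Hy').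
    exists x', y'; rewrite abs_opair; auto.
  - intros x Hx; destruct (H2 (incl x) Hx) as (y & Hy & U).
    destruct (lift_maps _ _ _ Hy) as (_ & y' & _ & ->).
    exists y'; split; [apply abs_maps, Hy|].
    intros z Hz; apply incl_inj, U, abs_maps, Hz.
Qed.

Lemma abs_ord_le (a b : N) : ord_le a b <-> ord_le (incl a) (incl b).
Proof.
  unfold ord_le; split; (intros [H|H]; [left; exact H|right]).
  - f_equal; exact H.
  - apply incl_inj, H.
Qed.

Lemma abs_cofinal_map (f d l : N) :
  is_cofinal_map f d l <-> is_cofinal_map (incl f) (incl d) (incl l).
Proof.
  unfold is_cofinal_map; rewrite abs_fun; split; intros [Hf H]; split; auto; intros x Hx.
  - destruct (lift x l Hx) as (x' & -> & Hx'); destruct (H x' Hx') as (i & y & Hi & Hy).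
    exists (incl i), (incl y); rewrite <- abs_maps, <- abs_ord_le; auto.
  - destruct (H (incl x) Hx) as (i & y & Hi & Hy).
    destruct (lift_maps _ _ _ Hi) as (i' & y' & -> & ->).
    exists i', y'; rewrite abs_maps, abs_ord_le; auto.
Qed.

(** In both directions the clause on least elements comes from foundation in V. *)
Lemma abs_ordinal {zfcV : ZFC V} (a : N) : is_ordinal a <-> is_ordinal (incl a).
Proof.
  split; intros (T & L & W).
  - apply ordinal_intro.
    + intros y Hy z Hz; destruct (lift y a Hy) as (y' & -> & Hy').
      destruct (lift z y' Hz) as (z' & -> & Hz'); exact (T y' Hy' z' Hz').
    + intros y z Hy Hz; destruct (lift y a Hy) as (y' & -> & Hy').
      destruct (lift z a Hz) as (z' & -> & Hz').
      destruct (L y' z' Hy' Hz') as [H|[H|H]]; [left|right; left|right; right]; auto.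
      f_equal; exact H.
  - split; [|split].
    + intros y Hy z Hz; exact (T (incl y) Hy (incl z) Hz).
    + intros y z Hy Hz; destruct (L (incl y) (incl z) Hy Hz) as [H|[H|H]]; auto.
      right; left; apply incl_inj, H.
    + intros s _ (y & Hy); destruct (foundation (incl s)) as (m & Hm & Hmin).
      { exists (incl y); exact Hy. }
      destruct (lift m s Hm) as (m' & -> & Hm'); exists m'; split; auto.
      intros z Hz; exact (Hmin (incl z) Hz).
Qed.

(** Every cofinal map of M is one in V, so d remains minimal in M; only its being attained there
    needs f in M. *)
Lemma is_cf_in_intro {zfcV : ZFC V} (f d l : V) : M f -> M d -> M l ->
  is_cf l d -> is_cofinal_map f d l -> is_cf_in M l d.
Proof.
  intros Mf Md Ml (Od & _ & Hmin) Hf.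
  exists (exist _ l Ml), (exist _ d Md); splits; auto; split; [apply abs_ordinal, Od|split].
  - exists (exist _ f Mf); apply abs_cofinal_map, Hf.
  - intros d' Od' (g & Hg); apply abs_ord_le, Hmin; [apply abs_ordinal, Od'|].
    exists (incl g); apply abs_cofinal_map in Hg; exact Hg.
Qed.

Lemma is_cf_in_map (d l : V) : is_cf_in M l d -> exists f, M f /\ is_cofinal_map f d l.
Proof.
  intros (l' & d' & <- & <- & _ & (f & Hf) & _).
  exists (incl f); split; [exact (proj2_sig f)|apply abs_cofinal_map, Hf].
Qed.
End Absoluteness.

(** * Ordinals and maps between ordinals in HOD *)

Section HODFacts.
Context {V : estruct} {zfcV : ZFC V}.
Implicit Types x y z a b c i m n s p f u l d D : V.

Lemma HOD_trans x y : HOD x -> y ∈ x -> HOD y.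
Proof.
  intros H Hy z Hz; apply H; intros t Tt Ht; apply Hz; auto.
  intros w ->; apply (Tt x); auto.
Qed.

Lemma OD_of_HOD x : HOD x -> OD x.
Proof. intro H; apply H; intros t _ Ht; apply Ht; reflexivity. Qed.

Lemma OD_term (t : V) : dtm Ords (fun _ => t) -> OD t.
Proof. intro H; apply (OD_of_dfn (fun z => z ∈ t)); [dfn_tac|tauto]. Qed.

Lemma HOD_ordinal a : is_ordinal a -> HOD a.
Proof.
  intros Oa x Hx; assert (Ox : x ∈ succ a).
  { apply Hx; [apply ord_succ, Oa|intros y ->; apply lt_succ_diag]. }
  apply OD_term, dtm_const, (ord_elem (succ a)); auto using ord_succ.
Qed.

(** Besides f, its pairs, the unordered pairs inside these and ordinals form a transitive class, all
    of whose members are definable from ordinals; cutting with V_b makes it a set. *)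
Lemma HOD_ordinal_map f : dtm Ords (fun _ => f) ->
  (forall p, p ∈ f -> exists x y, is_ordinal x /\ is_ordinal y /\ p = opair x y) -> HOD f.
Proof.
  intros Df Hf x Hx; destruct (Vr_exists f) as (b & Ob & Hb).
  pose (P := fun z => z = f \/ z ∈ f \/
    (exists x y, is_ordinal x /\ is_ordinal y /\ z = upair x y) \/ is_ordinal z).
  assert (Ht : forall z, z ∈ setof (fun z => z ∈ Vr b /\ P z) <-> z ∈ Vr b /\ P z).
  { apply in_sep; unfold P; dfn_tac. }
  assert (Px : P x).
  { apply (Ht x), Hx.
    - intros z Hz y Hy; apply Ht in Hz as [Hz Pz]; apply Ht.
      split; [apply (Vr_trans b y z); auto|].
      unfold P; destruct Pz as [-> |[Hzf|[(u & v & Ou & Ov & ->)|Oz]]]; auto.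
      + destruct (Hf z Hzf) as (u & v & Ou & Ov & ->).
        apply in_upair in Hy; right; right; left; destruct Hy as [-> | ->]; eauto.
      + right; right; right; apply in_upair in Hy as [-> | ->]; auto.
      + right; right; right; apply (ord_elem z); auto.
    - intros z ->; apply Ht; unfold P; auto. }
  destruct Px as [-> |[Hxf|[(u & v & Ou & Ov & ->)|Ox]]].
  - apply OD_term, Df.
  - destruct (Hf x Hxf) as (u & v & Ou & Ov & ->); apply OD_term; dfn_tac.
  - apply OD_term; dfn_tac.
  - apply OD_term; dfn_tac.
Qed.

Lemma cf_eq_cfHOD_intro f d l : is_ordinal l -> is_cf l d -> HOD f ->
  is_cofinal_map f d l -> cf_eq_cfHOD l.
Proof.
  intros Ol Hd Hf Hc; exists d; split; auto.
  apply (is_cf_in_intro HOD_trans f); auto using HOD_ordinal; apply HOD_ordinal, Hd.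
Qed.

Lemma cf_eq_cfHOD_map l : cf_eq_cfHOD l ->
  exists d f, is_cf l d /\ HOD f /\ is_cofinal_map f d l.
Proof.
  intros (d & Hd & Hi); destruct (is_cf_in_map HOD_trans _ _ Hi) as (f & Hf & Hc); eauto.
Qed.

(** * Order types of sets of ordinals *)

Definition next_element D s := least (fun x => x ∈ D /\ forall j y, maps s j y -> y ∈ x).
(** Defined by a recursion whose only parameter is [D], so the increasing enumeration is as
    definable as [D]. *)
Definition element D i := rec next_element D i.
(** The first stage at which the enumeration has exhausted [D]. *)
Definition order_type D :=
  least (fun i => ~ exists x, x ∈ D /\ forall j, j ∈ i -> element D j ∈ x).

Lemma dtm_next_element Q (t u : (nat -> V) -> V) : dtm Q t -> dtm Q u ->
  dtm Q (fun e => next_element (t e) (u e)).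
Proof. apply dtm_app2; unfold next_element; dfn_tac. Qed.
Hint Resolve dtm_next_element : dfn.

Lemma dtm_element Q (t u : (nat -> V) -> V) : dtm Q t -> dtm Q u ->
  dtm Q (fun e => element (t e) (u e)).
Proof. intros Ht Hu; unfold element; apply dtm_rec; dfn_tac. Qed.
Hint Resolve dtm_element : dfn.

Lemma dtm_order_type Q (t : (nat -> V) -> V) : dtm Q t -> dtm Q (fun e => order_type (t e)).
Proof. apply dtm_app1; unfold order_type; dfn_tac. Qed.

Section OrderType.
Context (D : V) (HD : forall x, x ∈ D -> is_ordinal x).

Lemma element_least i : is_ordinal i ->
  element D i = least (fun x => x ∈ D /\ forall j, j ∈ i -> element D j ∈ x).
Proof.
  intro Oi; destruct (rec_eq next_element D) as [Hd Hr]; [dfn_tac|].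
  unfold element at 1; rewrite (Hr i Oi); unfold next_element at 1.
  apply least_ext; intro x; split; intros [Hx H]; split; auto.
  - intros j Hj; apply (H j); apply maps_graph; auto.
  - intros j y Hj; apply maps_graph in Hj as [Hj ->]; auto; apply H, Hj.
Qed.

Lemma element_spec i : is_ordinal i ->
  (exists x, x ∈ D /\ forall j, j ∈ i -> element D j ∈ x) ->
  element D i ∈ D /\ (forall j, j ∈ i -> element D j ∈ element D i) /\
  forall x, x ∈ D -> (forall j, j ∈ i -> element D j ∈ x) -> ord_le (element D i) x.
Proof.
  intros Oi (x & Hx & H).
  destruct (least_spec (fun x => x ∈ D /\ forall j, j ∈ i -> element D j ∈ x))
    as (_ & [H1 H2] & H3); [dfn_tac|eauto|].
  rewrite <- (element_least i Oi) in *; splits; auto.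
Qed.

(** Were [D] never exhausted, the i-th element would be at least i for every ordinal i, which fails
    for i above the supremum of [D]. *)
Lemma order_type_spec : is_ordinal (order_type D) /\
  (~ exists x, x ∈ D /\ forall j, j ∈ order_type D -> element D j ∈ x) /\
  forall i, i ∈ order_type D -> exists x, x ∈ D /\ forall j, j ∈ i -> element D j ∈ x.
Proof.
  destruct (least_spec (fun i => ~ exists x, x ∈ D /\ forall j, j ∈ i -> element D j ∈ x))
    as (H1 & H2 & H3).
  - dfn_tac.
  - apply NNPP; intro N.
    assert (A : forall i, is_ordinal i -> exists x, x ∈ D /\ forall j, j ∈ i -> element D j ∈ x).
    { intros i Oi; apply NNPP; intro K; apply N; eauto. }
    assert (B : forall i, is_ordinal i -> ord_le i (element D i)).
    { apply (ord_ind (fun i => ord_le i (element D i))); [dfn_tac|].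
      intros i Oi IH; destruct (element_spec i Oi (A i Oi)) as (E1 & E2 & _).
      apply ord_subset; auto; intros j Hj.
      apply (le_lt_trans j (element D j)); auto. }
    pose (k := succ (bigcup D)).
    assert (Ok : is_ordinal k) by (apply ord_succ, ord_bigcup, HD).
    destruct (element_spec k Ok (A k Ok)) as (E1 & _).
    apply (le_not_lt k (element D k) (B k Ok)), lt_succ, le_bigcup; auto.
  - splits; auto; intros i Hi; apply NNPP; intro K.
    apply (le_not_lt (order_type D) i); auto; apply H3; auto; apply (ord_elem (order_type D)); auto.
Qed.

Lemma ord_order_type : is_ordinal (order_type D).
Proof. apply order_type_spec. Qed.

Lemma element_in i : i ∈ order_type D -> element D i ∈ D.
Proof.
  intro Hi; destruct order_type_spec as (Oo & _ & H).
  apply element_spec; auto; apply (ord_elem (order_type D)); auto.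
Qed.

Lemma element_lt i j : i ∈ order_type D -> j ∈ i -> element D j ∈ element D i.
Proof.
  intros Hi; destruct order_type_spec as (Oo & _ & H).
  apply element_spec; auto; apply (ord_elem (order_type D)); auto.
Qed.

(** Exhaustion gives an element at or above x; the first such is x, because all earlier ones are
    below x. *)
Lemma element_surj x : x ∈ D -> exists i, i ∈ order_type D /\ element D i = x.
Proof.
  intro Hx; destruct order_type_spec as (Oo & N & H).
  assert (exists i, i ∈ order_type D /\ ord_le x (element D i)) as (i0 & Hi0 & L0).
  { apply NNPP; intro K; apply N; exists x; split; auto; intros j Hj.
    destruct (ord_le_or_lt x (element D j)) as [L|L]; auto.
    - apply HD, element_in, Hj.
    - destruct K; eauto. }
  destruct (least_exists (fun i => ord_le x (element D i)) i0) as (i & Oi & L & Hmin & Li).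
  { dfn_tac. } { apply (ord_elem (order_type D)); auto. } { exact L0. }
  assert (Hi : i ∈ order_type D) by (eapply le_lt_trans; eauto).
  exists i; split; auto; apply le_antisym; auto.
  apply (element_spec i Oi (H i Hi)); auto; intros j Hj.
  assert (Hj' : j ∈ order_type D) by (eapply ord_trans; eauto).
  destruct (ord_le_or_lt x (element D j)) as [K|K]; auto.
  - apply HD, element_in, Hj'.
  - destruct (Hmin j Hj K).
Qed.

Lemma element_inj i j : i ∈ order_type D -> j ∈ order_type D ->
  element D i = element D j -> i = j.
Proof.
  intros Hi Hj E; pose proof ord_order_type as Oo.
  destruct (ord_trichotomy i j) as [H|[H|H]]; auto; try (apply (ord_elem (order_type D)); auto; fail).
  - destruct (mem_irrefl (element D j)); rewrite <- E at 1; apply element_lt; auto.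
  - destruct (mem_irrefl (element D i)); rewrite E at 1; apply element_lt; auto.
Qed.

Lemma element_ge i : i ∈ order_type D -> ord_le i (element D i).
Proof.
  pose proof ord_order_type as Oo.
  intro Hi; assert (Oi : is_ordinal i) by (apply (ord_elem (order_type D)); auto).
  revert i Oi Hi; apply (ord_ind (fun i => i ∈ order_type D -> ord_le i (element D i))).
  { pose proof (dtm_order_type Any); dfn_tac. }
  intros i Oi IH Hi; apply ord_subset; auto; [apply HD, element_in, Hi|].
  intros j Hj; apply (le_lt_trans j (element D j)).
  - apply HD, element_in, Hi.
  - apply IH; auto; eapply ord_trans; eauto.
  - apply element_lt; auto.
Qed.
End OrderType.
Hint Resolve dtm_order_type : dfn.

(** Otherwise k injects into d. As [is_cardinal] speaks of bijections, the range [E] of the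
    injection is replaced by its order type a <= d, and a is mapped bijectively onto k. *)
Lemma order_type_lt_cardinal k d D (j : V -> V) : is_cardinal k -> d ∈ k ->
  (forall x, x ∈ D -> is_ordinal x) -> dtm_any j -> (forall x, x ∈ D -> j x ∈ d) ->
  (forall x y, x ∈ D -> y ∈ D -> j x = j y -> x = y) -> order_type D ∈ k.
Proof.
  intros [Ok Hk] Hd HD Dj Hj Ij.
  assert (Od : is_ordinal d) by (apply (ord_elem k); auto).
  assert (Dj1 : forall t, dtm Any t -> dtm Any (fun e => j (t e))) by (apply dtm_app1; exact Dj).
  destruct (ord_le_or_lt k (order_type D)) as [L|L]; auto; [apply ord_order_type, HD|].
  exfalso.
  assert (S : subset k (order_type D)) by (apply le_subset; auto using ord_order_type).
  pose (h := fun i => j (element D i)).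
  assert (Dh : dtm_any h) by (unfold h; dfn_tac).
  assert (Dh1 : forall t, dtm Any t -> dtm Any (fun e => h (t e))) by (apply dtm_app1; exact Dh).
  assert (Hh : forall i, i ∈ k -> h i ∈ d) by (intros i Hi; apply Hj, element_in; auto).
  assert (Ih : forall i i', i ∈ k -> i' ∈ k -> h i = h i' -> i = i').
  { intros i i' Hi Hi' E; apply (element_inj D HD); auto.
    apply Ij; auto; apply element_in; auto. }
  pose (E := image h k).
  assert (HE : forall y, y ∈ E <-> exists i, i ∈ k /\ y = h i) by (apply in_image, Dh).
  assert (OE : forall y, y ∈ E -> is_ordinal y).
  { intros y Hy; apply HE in Hy as (i & Hi & ->); apply (ord_elem d); auto. }
  pose (a := order_type E); assert (Oa : is_ordinal a) by (apply ord_order_type, OE).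
  assert (Had : ord_le a d).
  { apply ord_subset; auto; intros i Hi.
    apply (le_lt_trans i (element E i)); auto; [apply element_ge; auto|].
    pose proof (element_in E OE i Hi) as Hin; apply HE in Hin as (i' & Hi' & ->); auto. }
  apply (Hk a); [eapply le_lt_trans; eauto|].
  pose (g := fun i => iota (fun x => x ∈ k /\ element E i = h x)).
  assert (Dg : dtm_any g) by (unfold g; dfn_tac).
  assert (Hg : forall i, i ∈ a -> g i ∈ k /\ element E i = h (g i)).
  { intros i Hi; pose proof (element_in E OE i Hi) as Hin; apply HE in Hin as (x & Hx & Ex).
    assert (g i = x) as ->; [|auto].
    apply iota_eq; auto; intros y [Hy Ey]; apply Ih; auto; congruence. }
  assert (M : forall x y, maps (graph g a) x y <-> x ∈ a /\ y = g x).
  { intros; apply maps_graph, Dg. }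
  exists (graph g a); split; [split|split].
  - intros p Hp; apply in_graph in Hp as (x & Hx & ->); auto.
    exists x, (g x); splits; auto; [apply Hg; auto|apply is_opair_iff; auto].
  - intros x Hx; exists (g x); split; [apply M; auto|]; intros y Hy; apply M in Hy as [_ ->]; auto.
  - intros x x' y H H'; apply M in H as [Hx ->], H' as [Hx' Ey].
    apply (element_inj E OE); auto; rewrite (proj2 (Hg x Hx)), (proj2 (Hg x' Hx')); congruence.
  - intros y Hy; destruct (element_surj E OE (h y)) as (i & Hi & Ei); [apply HE; eauto|].
    exists i; apply M; split; auto; apply Ih; auto; [apply Hg; auto|].
    rewrite <- (proj2 (Hg i Hi)); auto.
Qed.

End HODFacts.
#[export] Hint Resolve dtm_element dtm_order_type : dfn.

(** * Singular cardinals of uncountable cofinality *)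

Section Choice.
Context {V : estruct} {zfcV : ZFC V}.

(** The axiom of choice is stated for disjoint families; pairing each candidate y with x makes the
    cells disjoint. *)
Lemma choice_function (R : V -> V -> Prop) (a b : V) :
  dfn Any (fun e => R (e 0) (e 1)) ->
  (forall x, x ∈ a -> exists y, y ∈ b /\ R x y) ->
  exists F, dtm_any F /\ forall x, x ∈ a -> F x ∈ b /\ R x (F x).
Proof.
  intros HR H.
  assert (HR1 : forall t u : (nat -> V) -> V, dtm Any t -> dtm Any u ->
    dfn Any (fun e => R (t e) (u e))) by (apply dfn_app2; exact HR).
  pose (cell := fun x => image (fun y => opair x y) (setof (fun y => y ∈ b /\ R x y))).
  assert (Hcell : forall x z, z ∈ cell x <-> exists y, y ∈ b /\ R x y /\ z = opair x y).
  { intros x z; unfold cell; rewrite in_image by dfn_tac; split.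
    - intros (y & Hy & ->); apply in_sep in Hy as [Hy HRy]; [eauto|dfn_tac].
    - intros (y & Hy & HRy & ->); exists y; split; auto; apply in_sep; [dfn_tac|auto]. }
  assert (Dcell : dtm_any cell) by (unfold cell; dfn_tac).
  destruct (zfc_choice zfcV (x := image cell a)) as [c Hc].
  - intros y Hy; apply in_image in Hy as (x & Hx & ->); auto.
    destruct (H x Hx) as (z & Hz & HRz); exists (opair x z); apply Hcell; eauto.
  - intros y y' Hy Hy' (z & Hz & Hz').
    apply in_image in Hy as (x & Hx & ->), Hy' as (x' & Hx' & ->); auto.
    apply Hcell in Hz as (w & _ & _ & ->), Hz' as (w' & _ & _ & E).
    apply opair_inj in E as [-> _]; reflexivity.
  - exists (fun x => iota (fun y => y ∈ b /\ R x y /\ opair x y ∈ c)); split; [dfn_tac|].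
    intros x Hx; destruct (Hc (cell x)) as (z & [Hz Hzc] & U); [apply in_image; eauto|].
    apply Hcell in Hz as (y & Hy & HRy & ->).
    rewrite (iota_eq _ y); auto.
    intros y' (Hy' & HRy' & Hc'); assert (E : opair x y = opair x y').
    { apply U; split; auto; apply Hcell; eauto. }
    apply opair_inj in E; symmetry; tauto.
Qed.

Lemma is_fun_maps (f a b x y : V) : is_fun f a b -> maps f x y ->
  x ∈ a /\ y ∈ b /\ forall y', maps f x y' -> y' = y.
Proof.
  intros [H1 H2] Hxy; apply maps_iff in Hxy as Hp.
  destruct (H1 _ Hp) as (x' & y' & Hx & Hy & E); apply is_opair_iff, opair_inj in E as [<- <-].
  splits; auto; intros z Hz; destruct (H2 x Hx) as (w & _ & U).
  rewrite <- (U y Hxy), <- (U z Hz); reflexivity.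
Qed.

Lemma is_fun_app (f a b x : V) : is_fun f a b -> x ∈ a -> maps f x (app f x) /\ app f x ∈ b.
Proof.
  intros Hf Hx; destruct (proj2 Hf x Hx) as (y & Hy & U).
  destruct (is_fun_maps _ _ _ _ _ Hf Hy) as (_ & Hb & U').
  rewrite (app_eq f x y); auto.
Qed.

Lemma is_fun_graph (t : V -> V) (a b : V) : dtm_any t -> (forall x, x ∈ a -> t x ∈ b) ->
  is_fun (graph t a) a b.
Proof.
  intros Ht H; split.
  - intros p Hp; apply in_graph in Hp as (x & Hx & ->); auto.
    exists x, (t x); splits; auto; apply is_opair_iff; auto.
  - intros x Hx; exists (t x); split; [apply maps_graph; auto|].
    intros y Hy; apply maps_graph in Hy as [_ ->]; auto.
Qed.

Lemma is_cofinal_graph (t : V -> V) (a l : V) : dtm_any t -> (forall x, x ∈ a -> t x ∈ l) ->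
  (forall x, x ∈ l -> exists i, i ∈ a /\ ord_le x (t i)) -> is_cofinal_map (graph t a) a l.
Proof.
  intros Ht H Hc; split; [apply is_fun_graph; auto|].
  intros x Hx; destruct (Hc x Hx) as (i & Hi & L); exists i, (t i).
  split; auto; apply maps_graph; auto.
Qed.

Lemma is_cf_unique (l d d' : V) : is_cf l d -> is_cf l d' -> d = d'.
Proof. intros (Od & Hd & Md) (Od' & Hd' & Md'); apply le_antisym; auto. Qed.

End Choice.

(** * Uniformly chosen cofinal maps and the stationarity argument *)

Section DefinableCofinalMaps.
Context {V : estruct} {zfcV : ZFC V}.
Implicit Types x y z a b c d i n s p f k l : V.

Definition limit_point a s := forall x, x ∈ a -> exists y, y ∈ s /\ x ∈ y /\ y ∈ a.
Definition unbounded k s := subset s k /\ forall x, x ∈ k -> exists y, y ∈ s /\ x ∈ y.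

(** The domain may be any d up to omega, which is what minimality of the cofinality gives in
    [has_code_intro]. *)
Definition codes b c a := exists d, ord_le d omega /\ is_cofinal_map (od_val b c) d a.
Definition has_code a := exists b c, is_ordinal b /\ is_ordinal c /\ codes b c a.
Definition code1 a := least (fun b => exists c, is_ordinal c /\ codes b c a).
Definition code2 a := least (fun c => codes (code1 a) c a).
(** Least codes, first b and then c, make the choice definable from a alone. *)
Definition cof_map a := od_val (code1 a) (code2 a).

(** With f_n(a) the [n]-th value of [cof_map a]: g <= f_n(a) < b. *)
Definition value_between k n g b a :=
  a ∈ k /\ has_code a /\ exists y, maps (cof_map a) n y /\ ord_le g y /\ y ∈ b.

(** Stationarity, as the limit points of unbounded sets form a base of the closed
    unbounded filter. *)
Definition positive k n g b := forall s, unbounded k s ->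
  exists a, value_between k n g b a /\ limit_point a s.

Section Dfn.
Context {Q : pclass V}.
Implicit Types t u v : (nat -> V) -> V.

Lemma dfn_limit_point t u : dtm Q t -> dtm Q u -> dfn Q (fun e => limit_point (t e) (u e)).
Proof. apply dfn_app2; unfold limit_point; dfn_tac. Qed.
Lemma dfn_unbounded t u : dtm Q t -> dtm Q u -> dfn Q (fun e => unbounded (t e) (u e)).
Proof. apply dfn_app2; unfold unbounded; dfn_tac. Qed.
Lemma dfn_codes t u v : dtm Q t -> dtm Q u -> dtm Q v ->
  dfn Q (fun e => codes (t e) (u e) (v e)).
Proof. apply dfn_app3; unfold codes; dfn_tac. Qed.
#[local] Hint Resolve dfn_limit_point dfn_unbounded dfn_codes : dfn.
Lemma dfn_has_code t : dtm Q t -> dfn Q (fun e => has_code (t e)).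
Proof. apply (dfn_app1 (fun x e => has_code x)); unfold has_code; dfn_tac. Qed.
Lemma dtm_cof_map t : dtm Q t -> dtm Q (fun e => cof_map (t e)).
Proof. apply dtm_app1; unfold cof_map, code1, code2, code1; dfn_tac. Qed.
#[local] Hint Resolve dfn_has_code dtm_cof_map : dfn.
Lemma dfn_value_between t1 t2 t3 t4 t5 : dtm Q t1 -> dtm Q t2 -> dtm Q t3 -> dtm Q t4 ->
  dtm Q t5 -> dfn Q (fun e => value_between (t1 e) (t2 e) (t3 e) (t4 e) (t5 e)).
Proof.
  intros; unfold value_between; apply dfn_and; [dfn_tac|apply dfn_and; [dfn_tac|]].
  apply (dfn_app4 (fun x y z w => exists p, maps (cof_map x) y p /\ ord_le z p /\ p ∈ w));
    dfn_tac.
Qed.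
#[local] Hint Resolve dfn_value_between : dfn.
Lemma dfn_positive t1 t2 t3 t4 : dtm Q t1 -> dtm Q t2 -> dtm Q t3 -> dtm Q t4 ->
  dfn Q (fun e => positive (t1 e) (t2 e) (t3 e) (t4 e)).
Proof. apply dfn_app4; unfold positive; dfn_tac. Qed.
End Dfn.
#[local] Hint Resolve dfn_limit_point dfn_unbounded dfn_codes dfn_has_code
  dfn_value_between dfn_positive : dfn.

Lemma cof_map_spec a : has_code a ->
  exists d, ord_le d omega /\ is_cofinal_map (cof_map a) d a.
Proof.
  intros (b & c & Ob & Oc & H).
  destruct (least_spec (fun b => exists c, is_ordinal c /\ codes b c a)) as (_ & (c' & Oc' & H') & _);
    [dfn_tac|exists b; split; auto; exists c; auto|].
  destruct (least_spec (fun c => codes (code1 a) c a)) as (_ & H2 & _);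
    [dfn_tac|exists c'; auto|].
  exact H2.
Qed.

(** The map g of V bounds the cofinality by omega; the map that gets coded is the one in HOD with
    the cofinality as domain. *)
Lemma has_code_intro a g : cf_eq_cfHOD a -> is_cofinal_map g omega a -> has_code a.
Proof.
  intros Ha Hg; destruct (cf_eq_cfHOD_map a Ha) as (d & f & Hd & Hf & Hc).
  destruct (OD_od_val f) as (b & c & Ob & Oc & ->); [apply OD_of_HOD, Hf|].
  exists b, c; splits; auto; exists d; split; auto; apply Hd; eauto using ord_omega.
Qed.

Context (kappa delta : V) (Ck : is_cardinal kappa) (Hcf : is_cf kappa delta)
  (Hod : omega ∈ delta) (Hdk : delta ∈ kappa).

Lemma ord_kappa : is_ordinal kappa.
Proof. apply Ck. Qed.

Lemma ord_delta : is_ordinal delta.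
Proof. apply Hcf. Qed.
#[local] Hint Resolve ord_kappa ord_delta : core.

Lemma ord_in_kappa x : x ∈ kappa -> is_ordinal x.
Proof. apply ord_elem; auto. Qed.

Lemma ord_in_delta x : x ∈ delta -> is_ordinal x.
Proof. apply ord_elem; auto. Qed.
#[local] Hint Resolve ord_in_kappa ord_in_delta : core.

Lemma bounded_below_cf m (t : V -> V) : m ∈ delta -> dtm_any t ->
  (forall i, i ∈ m -> t i ∈ kappa) -> exists b, b ∈ kappa /\ forall i, i ∈ m -> t i ∈ b.
Proof.
  intros Hm Dt Ht; apply NNPP; intro N.
  apply (le_not_lt delta m); auto; apply Hcf; auto.
  exists (graph t m); apply is_cofinal_graph; auto.
  intros x Hx; apply NNPP; intro K; apply N; exists x; split; auto; intros i Hi.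
  destruct (ord_le_or_lt x (t i)) as [L|L]; auto; destruct K; eauto.
Qed.

(** A family indexed by 1 is bounded below kappa, since 1 < omega < delta. *)
Lemma kappa_succ x : x ∈ kappa -> succ x ∈ kappa.
Proof.
  intro Hx.
  assert (H1 : succ empty ∈ omega) by apply succ_in_omega, zero_in_omega.
  destruct (bounded_below_cf (succ empty) (fun _ => x)) as (b & Hb & H); auto.
  - eapply ord_trans; eauto.
  - dfn_tac.
  - apply (le_lt_trans (succ x) b); auto; apply succ_le; auto.
    apply (H empty), lt_succ_diag.
Qed.

Lemma kappa_ub2 x y : x ∈ kappa -> y ∈ kappa ->
  exists z, z ∈ kappa /\ ord_le x z /\ ord_le y z.
Proof.
  intros Hx Hy; destruct (ord_ub2 x y) as (z & E & _ & H1 & H2); auto.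
  exists z; splits; auto; destruct E as [-> | ->]; auto.
Qed.

(** h(i) is the supremum of the values of a cofinal map at the j <= i, which is below kappa because
    i < delta. *)
Lemma monotone_cofinal_map : exists h : V -> V, dtm_any h /\
  (forall i, i ∈ delta -> h i ∈ kappa) /\
  (forall i j, j ∈ delta -> ord_le i j -> ord_le (h i) (h j)) /\
  forall x, x ∈ kappa -> exists i, i ∈ delta /\ x ∈ h i.
Proof.
  destruct Hcf as (_ & (f & Hf & Hfc) & _).
  pose (P := fun i y => forall j, ord_le j i -> ord_le (app f j) y).
  pose (h := fun i => least (P i)).
  assert (DP : forall i, dfn_any (P i)) by (intro i; unfold P; dfn_tac).
  assert (Ex : forall i, i ∈ delta -> exists y, y ∈ kappa /\ P i y).
  { intros i Hi; destruct (bounded_below_cf i (app f)) as (b & Hb & H); auto.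
    - dfn_tac.
    - intros j Hj; apply (is_fun_app f delta kappa); auto; eapply ord_trans; eauto.
    - destruct (is_fun_app f delta kappa i Hf Hi) as [_ Hfi].
      destruct (kappa_ub2 b (app f i)) as (z & Hz & H1 & H2); auto.
      exists z; split; auto; intros j [Hj| ->]; auto; left; eapply lt_le_trans; eauto. }
  assert (Sp : forall i, i ∈ delta -> is_ordinal (h i) /\ P i (h i) /\
    forall y, is_ordinal y -> P i y -> ord_le (h i) y).
  { intros i Hi; apply least_spec; auto; destruct (Ex i Hi) as (y & Hy & H); eauto. }
  exists h; splits.
  - unfold h, P; dfn_tac.
  - intros i Hi; destruct (Ex i Hi) as (y & Hy & H).
    apply (le_lt_trans (h i) y); auto; apply (Sp i Hi); auto.
  - intros i j Hj Hij; destruct (Sp j Hj) as (Oj & Pj & _).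
    apply Sp; auto; [eapply le_lt_trans; eauto|].
    intros x Hx; apply Pj; eapply le_trans; eauto.
  (* Covering [succ x] instead of x gives the strict inequality. *)
  - intros x Hx; destruct (Hfc (succ x) (kappa_succ x Hx)) as (i & y & Hy & L).
    destruct (is_fun_maps _ _ _ _ _ Hf Hy) as (Hi & _ & U).
    exists i; split; auto; destruct (Sp i Hi) as (Oi & Pi & _).
    apply (lt_le_trans x (succ x)); auto using lt_succ_diag.
    apply (le_trans (succ x) y); auto.
    rewrite <- (app_eq f i y); auto using ord_le_refl.
Qed.

Lemma closing_kappa (R : V -> V -> Prop) : dfn Any (fun e => R (e 0) (e 1)) ->
  (forall x, x ∈ kappa -> exists y, y ∈ kappa /\ x ∈ y /\ R x y) ->
  forall a, a ∈ kappa -> exists l, l ∈ kappa /\ a ∈ l /\ is_limit l /\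
    (forall x, x ∈ l -> exists z y, ord_le x z /\ z ∈ y /\ y ∈ l /\ R z y) /\
    exists g, is_cofinal_map g omega l.
Proof.
  intros HR H a Ha; apply (closing (fun x => x ∈ kappa)); auto.
  - dfn_tac.
  - intros; eapply ord_trans; eauto.
  - intros F HF HK; apply bounded_below_cf; auto.
Qed.

(** u is the set of common limit points, unbounded by the closing argument; limits of limit points
    are again limit points. *)
Lemma common_limit_points s s' : unbounded kappa s -> unbounded kappa s' ->
  exists u, unbounded kappa u /\ forall a, is_ordinal a -> limit_point a u ->
    limit_point a s /\ limit_point a s'.
Proof.
  intros [Hs Us] [Hs' Us'].
  pose (u := setof (fun a => a ∈ kappa /\ (limit_point a s /\ limit_point a s'))).
  assert (Hu : forall a, a ∈ u <-> a ∈ kappa /\ limit_point a s /\ limit_point a s').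
  { apply in_sep; dfn_tac. }
  exists u; split; [split|].
  - intros x Hx; apply Hu, Hx.
  - intros x Hx.
    destruct (closing_kappa (fun x y => (exists z, z ∈ s /\ x ∈ z /\ z ∈ y) /\
      exists z, z ∈ s' /\ x ∈ z /\ z ∈ y)) with (a := x) as (l & Hl & Hxl & Ll & C & _); auto.
    + dfn_tac.
    + intros y Hy; destruct (Us y Hy) as (z & Hz & Hyz), (Us' y Hy) as (z' & Hz' & Hyz').
      destruct (kappa_ub2 (succ z) (succ z')) as (w & Hw & L & L'); auto using kappa_succ.
      assert (z ∈ w) by (apply (lt_le_trans z (succ z)); auto using lt_succ_diag).
      assert (z' ∈ w) by (apply (lt_le_trans z' (succ z')); auto using lt_succ_diag).
      exists w; splits; eauto; eapply ord_trans; eauto.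
    + exists l; split; auto; apply Hu; splits; auto; intros y Hy;
        destruct (C y Hy) as (z & w & L & _ & Hw & (v & Hv & K1 & K2) & (v' & Hv' & K1' & K2')).
      * exists v; splits; auto; [eapply le_lt_trans; eauto|eapply ord_trans; eauto].
      * exists v'; splits; auto; [eapply le_lt_trans; eauto|eapply ord_trans; eauto].
  - intros a Oa H; split; intros x Hx; destruct (H x Hx) as (y & Hy & Hxy & Hya);
      apply Hu in Hy as (_ & L & L').
    + destruct (L x Hxy) as (z & Hz & K1 & K2); exists z; splits; auto; eapply ord_trans; eauto.
    + destruct (L' x Hxy) as (z & Hz & K1 & K2); exists z; splits; auto; eapply ord_trans; eauto.
Qed.

Context (cf_below : forall l, is_ordinal l -> l ∈ kappa -> cf_eq_cfHOD l).

(** The increasing enumeration of [D] carries a cofinal map of HOD into the order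
    type of [D] to one into [kappa]. *)
Lemma cf_eq_of_short_unbounded D : dtm Ords (fun _ => D) -> unbounded kappa D ->
  order_type D ∈ kappa -> cf_eq_cfHOD kappa.
Proof.
  intros DD [HD UD] Ho.
  assert (OD' : forall x, x ∈ D -> is_ordinal x) by auto.
  assert (Oo : is_ordinal (order_type D)) by auto.
  destruct (cf_eq_cfHOD_map _ (cf_below _ Oo Ho)) as (d & f & Hd & Hf & Hfc).
  (* Writing f through its ordinal codes keeps the composite map definable from ordinals. *)
  destruct (OD_od_val f) as (b & c & Ob & Oc & ->); [apply OD_of_HOD, Hf|].
  destruct monotone_cofinal_map as (h & Dh & Hh & Mh & Ch).
  assert (Dh1 : forall t, dtm Any t -> dtm Any (fun e => h (t e))) by (apply dtm_app1; exact Dh).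
  assert (El : forall i j, j ∈ order_type D -> ord_le i j -> ord_le (element D i) (element D j)).
  { intros i j Hj [H| ->]; [left; apply element_lt; auto|apply ord_le_refl]. }
  pose (t := fun i => element D (app (od_val b c) i)).
  assert (Hc : is_cofinal_map (graph t d) d kappa).
  { apply is_cofinal_graph.
    - unfold t; dfn_tac.
    - intros i Hi; apply HD, element_in; auto.
      apply (is_fun_app _ _ _ _ (proj1 Hfc) Hi).
    - intros x Hx; destruct (UD x Hx) as (y & Hy & Hxy).
      destruct (element_surj D OD' y Hy) as (i & Hi & Ei).
      destruct (proj2 Hfc i Hi) as (j & z & Hz & L).
      destruct (is_fun_maps _ _ _ _ _ (proj1 Hfc) Hz) as (Hj & Hzo & U).
      exists j; split; auto; left; unfold t; rewrite (app_eq _ _ z); auto.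
      apply (lt_le_trans x y); [apply OD', element_in; auto|auto|].
      rewrite <- Ei; apply El; auto. }
  assert (d = delta) as ->.
  { apply le_antisym; [|apply Hcf; [apply Hd|eauto]].
    (* Sending i to the first index whose element reaches h(i) is cofinal in the order type, so d <=
       delta. *)
    pose (r := fun i => least (fun j => j ∈ order_type D /\ ord_le (h i) (element D j))).
    assert (Hr : forall i, i ∈ delta -> r i ∈ order_type D /\ ord_le (h i) (element D (r i))).
    { intros i Hi; destruct (least_spec (fun j => j ∈ order_type D /\ ord_le (h i) (element D j)))
        as (_ & H & _); auto; [dfn_tac|].
      destruct (UD (h i) (Hh i Hi)) as (y & Hy & L).
      destruct (element_surj D OD' y Hy) as (j & Hj & <-).
      exists j; splits; auto; [apply (ord_elem (order_type D)); auto|left; auto]. }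
    apply Hd; auto; exists (graph r delta); apply is_cofinal_graph.
    - unfold r; dfn_tac.
    - intros i Hi; apply Hr, Hi.
    - intros x Hx; destruct (Ch (element D x)) as (i & Hi & L); [apply HD, element_in; auto|].
      exists i; split; auto; destruct (Hr i Hi) as [K1 K2].
      assert (Ox : is_ordinal x) by (apply (ord_elem (order_type D)); auto).
      assert (Or : is_ordinal (r i)) by (apply (ord_elem (order_type D)); auto).
      destruct (ord_le_or_lt x (r i)) as [|G]; auto; exfalso.
      apply (le_not_lt (h i) (element D x)); auto.
      eapply le_trans; [|exact K2|]; [apply OD', element_in; auto|].
      apply El; auto; left; auto. }
  apply (cf_eq_cfHOD_intro (graph t delta) delta); auto.
  assert (Dt : dtm Ords (fun _ => graph t delta)).
  { unfold t; pose proof ord_delta; dfn_tac. }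
  apply HOD_ordinal_map; [exact Dt|].
  intros p Hp; apply in_graph in Hp as (x & Hx & ->); [|unfold t; dfn_tac].
  exists x, (t x); splits; auto; apply OD', element_in; auto.
  apply (is_fun_app _ _ _ _ (proj1 Hfc) Hx).
Qed.

Lemma value_unique k n g b a y y' : value_between k n g b a ->
  maps (cof_map a) n y -> maps (cof_map a) n y' -> y = y'.
Proof.
  intros (_ & Ha & _) H H'; destruct (cof_map_spec a Ha) as (d & _ & Hf & _).
  symmetry; exact (proj2 (proj2 (is_fun_maps _ _ _ _ _ Hf H)) y' H').
Qed.

Lemma positive_mono k n g g' b : is_ordinal b -> ord_le g g' ->
  positive k n g' b -> positive k n g b.
Proof.
  intros Ob L H s Hs; destruct (H s Hs) as (a & (Ha & Ca & y & Hy & Ly & Hb) & Ls).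
  exists a; split; auto; split; [auto|split; [auto|]]; exists y; splits; auto.
  apply (le_trans g g'); auto; apply (ord_elem b); auto.
Qed.

(** [D] below consists of the [b] at which the increasing sequence of the sets
    {a | f_n(a) < b} grows modulo nonstationary sets; disjoint intervals between
    its elements contain values at distinct limit points of a cofinal sequence. *)
Lemma cf_eq_of_positive n : n ∈ omega ->
  (forall g, g ∈ kappa -> exists b, b ∈ kappa /\ positive kappa n g b) -> cf_eq_cfHOD kappa.
Proof.
  intros Hn HP.
  assert (On : is_ordinal n) by (apply ord_nat, Hn).
  pose (D := setof (fun b => b ∈ kappa /\ forall g, g ∈ b -> positive kappa n g b)).
  assert (HD : forall b, b ∈ D <-> b ∈ kappa /\ forall g, g ∈ b -> positive kappa n g b).
  { apply (in_sep kappa (fun b => forall g, g ∈ b -> positive kappa n g b)); dfn_tac. }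
  assert (OD' : forall b, b ∈ D -> is_ordinal b) by (intros b Hb; apply HD in Hb; apply ord_in_kappa, Hb).
  assert (DD : dtm Ords (fun _ => D)).
  { pose proof ord_kappa; unfold D; dfn_tac. }
  assert (Uk : unbounded kappa kappa).
  { split; [intros x Hx; exact Hx|]; intros x Hx; exists (succ x).
    split; [apply kappa_succ, Hx|apply lt_succ_diag]. }
  assert (UD : unbounded kappa D).
  { split; [intros b Hb; apply HD in Hb; apply Hb|]; intros g0 Hg0.
    destruct (HP g0 Hg0) as (b0 & Hb0 & P0).
    (* The least b that is positive over g0 belongs to [D]. *)
    destruct (least_exists (fun b => positive kappa n g0 b) b0) as (b & Ob & Pb & Hmin & Lb); auto.
    { dfn_tac. }
    assert (Hb : b ∈ kappa) by (eapply le_lt_trans; eauto).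
    assert (Hg0b : g0 ∈ b).
    { destruct (Pb kappa Uk) as (a & (_ & _ & y & _ & Ly & Hy) & _).
      eapply le_lt_trans; eauto. }
    exists b; split; auto; apply HD; split; auto; intros g Hg s Hs.
    assert (Og : is_ordinal g) by (apply (ord_elem b); auto).
    destruct (classic (exists s', unbounded kappa s' /\
      forall a, value_between kappa n g0 g a -> ~ limit_point a s')) as [(s' & Hs' & N)|N].
    - destruct (common_limit_points s s' Hs Hs') as (u & Hu & Lu).
      destruct (Pb u Hu) as (a & Va & La); pose proof Va as (Ha & Ca & y & Hy & Ly & Hyb).
      destruct (Lu a) as [L1 L2]; auto.
      exists a; split; auto; split; [auto|split; [auto|]]; exists y; splits; auto.
      destruct (ord_le_or_lt g y) as [|K]; auto; [apply (ord_elem b); auto|].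
      destruct (N a); auto; split; [auto|split; [auto|]]; exists y; auto.
    - destruct (Hmin g Hg); intros s' Hs'; apply NNPP; intro K; apply N; exists s'.
      split; auto; intros a Va La; apply K; eauto. }
  apply (cf_eq_of_short_unbounded D); auto.
  destruct monotone_cofinal_map as (h & Dh & Hh & Mh & Ch).
  assert (Dh1 : forall t, dtm Any t -> dtm Any (fun e => h (t e))) by (apply dtm_app1; exact Dh).
  pose (nxt := fun x => least (fun b => b ∈ D /\ x ∈ b)).
  assert (Dnxt : dtm_any nxt) by (unfold nxt; dfn_tac).
  assert (Dnxt1 : forall t, dtm Any t -> dtm Any (fun e => nxt (t e))) by (apply dtm_app1; exact Dnxt).
  assert (Hnxt : forall x, x ∈ D -> (nxt x ∈ D /\ x ∈ nxt x) /\
    forall y, y ∈ D -> x ∈ y -> ord_le (nxt x) y).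
  { intros x Hx; destruct (least_spec (fun b => b ∈ D /\ x ∈ b)) as (_ & H1 & H2).
    - dfn_tac.
    - destruct (proj2 UD x) as (b & Hb & Hxb); [apply UD, Hx|]; exists b; auto.
    - split; [exact H1|]; intros y Hy Hxy; apply H2; auto. }
  pose (E := image h delta).
  assert (HE : forall y, y ∈ E <-> exists i, i ∈ delta /\ y = h i) by (apply in_image, Dh).
  assert (UE : unbounded kappa E).
  { split.
    - intros y Hy; apply HE in Hy as (i & Hi & ->); auto.
    - intros x Hx; destruct (Ch x Hx) as (i & Hi & L); exists (h i); split; auto; apply HE; eauto. }
  (* Such a point exists because x < [nxt x] and [nxt x] is in [D]. *)
  pose (pt := fun x => least (fun a => value_between kappa n x (nxt x) a /\ limit_point a E)).
  assert (Dpt : dtm_any pt) by (unfold pt; dfn_tac).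
  assert (Dpt1 : forall t, dtm Any t -> dtm Any (fun e => pt (t e))) by (apply dtm_app1; exact Dpt).
  assert (Hpt : forall x, x ∈ D -> value_between kappa n x (nxt x) (pt x) /\ limit_point (pt x) E).
  { intros x Hx; destruct (Hnxt x Hx) as [[H1 H2] _].
    destruct (least_spec (fun a => value_between kappa n x (nxt x) a /\ limit_point a E))
      as (_ & H & _); [dfn_tac| |exact H].
    apply HD in H1 as [_ H1]; destruct (H1 x H2 E UE) as (a & Va & La).
    exists a; split; auto; apply ord_in_kappa, Va. }
  pose (j := fun x => least (fun i => i ∈ delta /\ ord_le (pt x) (h i))).
  assert (Hj : forall x, x ∈ D -> j x ∈ delta /\ ord_le (pt x) (h (j x)) /\
    forall i, i ∈ delta -> ord_le (pt x) (h i) -> ord_le (j x) i).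
  { intros x Hx; destruct (Hpt x Hx) as [(Hk & _) _].
    destruct (least_spec (fun i => i ∈ delta /\ ord_le (pt x) (h i))) as (_ & [H1 H2] & H3).
    - dfn_tac.
    - destruct (Ch (pt x) Hk) as (i & Hi & L); exists i; splits; auto; left; auto.
    - splits; auto. }
  (* The limit point [pt y] has some h(i) strictly between [pt x] and itself, so j(x) <= i while
     h(i) does not yet reach [pt y]. *)
  assert (Sep : forall x y, x ∈ D -> y ∈ D -> pt x ∈ pt y -> j x <> j y).
  { intros x y Hx Hy L E0; destruct (Hpt y Hy) as [(Hk & _) Ly].
    destruct (Ly (pt x) L) as (z & Hz & K1 & K2); apply HE in Hz as (i & Hi & ->).
    destruct (Hj x Hx) as (_ & _ & M1), (Hj y Hy) as (Hjy & M2 & _).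
    assert (L1 : ord_le (j y) i) by (rewrite <- E0; apply M1; auto; left; auto).
    apply (le_not_lt (pt y) (h i)); auto.
    apply (le_trans (pt y) (h (j y))); auto. }
  apply (order_type_lt_cardinal kappa delta D j); auto.
  - unfold j; dfn_tac.
  - intros x Hx; apply Hj, Hx.
  (* The value of f_n at [pt x] is below [nxt x] <= y, and the one at [pt y] is at least y. *)
  - assert (Lt : forall x y, x ∈ D -> y ∈ D -> x ∈ y -> pt x <> pt y).
    { intros x y Hx Hy L E0; destruct (Hnxt x Hx) as [_ H1].
      destruct (Hpt x Hx) as [Vx _], (Hpt y Hy) as [Vy _]; pose proof Vx as Vx'.
      destruct Vx as (_ & _ & v & Hv & _ & Lv), Vy as (_ & _ & w & Hw & Lw & _).
      rewrite <- E0 in Hw.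
      assert (v = w) as <- by (eapply value_unique; eauto).
      assert (Oy : is_ordinal y) by auto.
      apply (le_not_lt y v Lw); apply (lt_le_trans v (nxt x)); auto. }
    intros x y Hx Hy Ej; apply NNPP; intro N.
    assert (Ne : pt x <> pt y).
    { destruct (ord_trichotomy x y) as [L|[L|L]]; auto.
      intro K; apply (Lt y x); auto. }
    destruct (ord_trichotomy (pt x) (pt y)) as [L|[L|L]]; auto.
    + apply ord_in_kappa, (Hpt x Hx).
    + apply ord_in_kappa, (Hpt y Hy).
    + apply (Sep x y); auto.
    + apply (Sep y x); auto.
Qed.

(** If the sets {a | g <= f_n(a) < b} are nonstationary for some [g] and all [n] and [b],
    a point of countable cofinality above [g] chosen by the closing lemma is a
    limit of every witness and yet has a value of its cofinal map above [g]. *)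
Lemma some_positive : exists n, n ∈ omega /\
  forall g, g ∈ kappa -> exists b, b ∈ kappa /\ positive kappa n g b.
Proof.
  apply NNPP; intro N.
  assert (A : forall n, n ∈ omega -> exists g, g ∈ kappa /\
    forall b, b ∈ kappa -> ~ positive kappa n g b).
  { intros n Hn; apply NNPP; intro K; apply N; exists n; split; auto; intros g Hg.
    apply NNPP; intro K'; apply K; exists g; split; auto; intros b Hb P; apply K'; eauto. }
  pose (g0 := fun n => least (fun g => g ∈ kappa /\ forall b, b ∈ kappa -> ~ positive kappa n g b)).
  assert (Hg0 : forall n, n ∈ omega -> g0 n ∈ kappa /\
    forall b, b ∈ kappa -> ~ positive kappa n (g0 n) b).
  { intros n Hn; destruct (least_spec (fun g => g ∈ kappa /\ forall b, b ∈ kappa -> ~ positive kappa n g b))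
      as (_ & H & _); [dfn_tac| |exact H].
    destruct (A n Hn) as (g & Hg & H); exists g; split; auto. }
  destruct (bounded_below_cf omega g0) as (g & Hg & Hgn); auto.
  { unfold g0; dfn_tac. }
  { intros n Hn; apply Hg0, Hn. }
  destruct monotone_cofinal_map as (h & Dh & Hh & Mh & Ch).
  assert (Dh1 : forall t, dtm Any t -> dtm Any (fun e => h (t e))) by (apply dtm_app1; exact Dh).
  destruct (lim_above_spec delta) as [Ll Hdl]; auto.
  set (l := lim_above delta) in *; clearbody l.
  assert (Ol : is_ordinal l) by apply Ll.
  (* The product of omega and delta, cut out of V_l, which is closed under pairs. *)
  pose (a := setof (fun p => p ∈ Vr l /\ exists n i, n ∈ omega /\ i ∈ delta /\ p = opair n i)).
  assert (Ha : forall n i, n ∈ omega -> i ∈ delta -> opair n i ∈ a).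
  { intros n i Hn Hi; apply (in_sep (Vr l)); [dfn_tac|]; split; [|eauto].
    assert (S : forall x, x ∈ delta -> x ∈ Vr l).
    { intros x Hx; apply ord_subset_Vr; auto; eapply ord_trans; eauto. }
    apply opair_Vr; auto; apply S; eapply ord_trans; eauto. }
  (* The bounds h(i) are cofinal in kappa, so delta many witnesses, chosen at once, suffice for all
     b. *)
  pose (W := fun p s => forall n i, p = opair n i -> unbounded kappa s /\
    forall x, value_between kappa n g (h i) x -> ~ limit_point x s).
  destruct (choice_function W a (power kappa)) as (F & DF & HF).
  { unfold W; dfn_tac. }
  { intros p Hp; apply (in_sep (Vr l)) in Hp as (_ & n & i & Hn & Hi & ->); [|dfn_tac].
    destruct (Hg0 n Hn) as [Hgk Hp].
    assert (NP : ~ positive kappa n g (h i)).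
    { intro P; apply (Hp (h i)); auto; apply (positive_mono kappa n (g0 n) g); auto.
      left; auto. }
    apply NNPP; intro K; apply NP; intros s Hs; apply NNPP; intro K'; apply K.
    exists s; split; [apply in_power, Hs|].
    intros n' i' E; apply opair_inj in E as [<- <-]; split; auto.
    intros x Vx Lx; apply K'; eauto. }
  assert (DF1 : forall t, dtm Any t -> dtm Any (fun e => F (t e))) by (apply dtm_app1; exact DF).
  assert (HE : forall n i, n ∈ omega -> i ∈ delta -> unbounded kappa (F (opair n i)) /\
    forall x, value_between kappa n g (h i) x -> ~ limit_point x (F (opair n i))).
  { intros n i Hn Hi; destruct (HF _ (Ha n i Hn Hi)) as [_ H]; apply H; reflexivity. }
  (* The diagonal condition: only the i with h(i) < x are treated at x. Their indices are bounded in
     delta, so a suitable y < kappa exists. *)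
  pose (R := fun x y => (exists i, i ∈ delta /\ x ∈ h i /\ h i ∈ y) /\
    forall n, n ∈ omega -> forall i, i ∈ delta -> h i ∈ x ->
      exists z, z ∈ F (opair n i) /\ x ∈ z /\ z ∈ y).
  destruct (closing_kappa R) with (a := g) as (x & Hx & Hgx & Lx & C & (c & Hc)); auto.
  { unfold R; dfn_tac. }
  { intros x Hx; destruct (Ch x Hx) as (i0 & Hi0 & L0).
    pose (t := fun i n => least (fun z => z ∈ F (opair n i) /\ x ∈ z)).
    assert (Ht : forall i n, i ∈ delta -> n ∈ omega ->
      t i n ∈ F (opair n i) /\ x ∈ t i n /\ t i n ∈ kappa).
    { intros i n Hi Hn; destruct (HE n i Hn Hi) as [[HS HU] _].
      destruct (least_spec (fun z => z ∈ F (opair n i) /\ x ∈ z)) as (_ & [H1 H2] & _).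
      - dfn_tac.
      - destruct (HU x Hx) as (z & Hz & L); exists z; split; auto.
      - splits; auto. }
    (* Bounds are taken in two rounds, first over the n < omega and then over the i < i0; both index
       sets are shorter than delta. *)
    pose (s := fun i => least (fun b => b ∈ kappa /\ forall n, n ∈ omega -> t i n ∈ b)).
    assert (Hs : forall i, i ∈ delta -> s i ∈ kappa /\ forall n, n ∈ omega -> t i n ∈ s i).
    { intros i Hi; destruct (least_spec (fun b => b ∈ kappa /\ forall n, n ∈ omega -> t i n ∈ b))
        as (_ & H & _); [unfold t; dfn_tac| |exact H].
      destruct (bounded_below_cf omega (t i)) as (b & Hb & H); auto.
      - unfold t; dfn_tac.
      - intros n Hn; apply Ht; auto.
      - exists b; split; auto. }
    destruct (bounded_below_cf i0 s) as (b & Hb & H); auto.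
    { unfold s, t; dfn_tac. }
    { intros i Hi; apply Hs; eapply ord_trans; eauto. }
    destruct (kappa_ub2 b (succ (h i0))) as (y & Hy & L1 & L2); auto using kappa_succ.
    assert (Hiy : h i0 ∈ y) by (apply (lt_le_trans (h i0) (succ (h i0))); auto using lt_succ_diag).
    exists y; splits; auto; [eapply ord_trans; eauto|]; split; [eauto|].
    intros n Hn i Hi Hix; assert (Hii : i ∈ i0).
    { destruct (ord_le_or_lt i0 i) as [L|]; auto; exfalso.
      apply (le_not_lt (h i0) (h i)); auto; eapply ord_trans; eauto. }
    destruct (Ht i n Hi Hn) as (K1 & K2 & K3); exists (t i n); splits; auto.
    apply (lt_le_trans (t i n) b); auto; apply (ord_trans (t i n) (s i)); auto; apply Hs; auto. }
  assert (Ox : is_ordinal x) by auto.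
  assert (Cx : has_code x) by (apply (has_code_intro x c); auto).
  destruct (cof_map_spec x Cx) as (d & Hd & Hf).
  (* As g < x, some value y = f_n(x) is at least g; below, h(i) is found with y < h(i) < x. *)
  destruct (proj2 Hf g Hgx) as (n & y & Hy & Ly).
  destruct (is_fun_maps _ _ _ _ _ (proj1 Hf) Hy) as (Hn & Hyx & _).
  assert (Hno : n ∈ omega) by (apply (lt_le_trans n d); auto using ord_omega).
  destruct (C y Hyx) as (z & w & Lyz & _ & Hw & (i & Hi & Hzi & Hiw) & _).
  assert (Hix : h i ∈ x) by (eapply ord_trans; eauto).
  destruct (HE n i Hno Hi) as [_ HN]; apply (HN x).
  - split; [auto|split; [auto|]]; exists y; splits; auto.
    eapply le_lt_trans; eauto.
  - intros v Hv.
    (* v is raised above h(i), so that the closing step starting beyond m already takes the witness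
       for (n, i) into account. *)
    destruct (ord_ub2 v (succ (h i))) as (m & Em & Om & L1 & L2).
    { apply (ord_elem x); auto. } { apply ord_succ; auto. }
    assert (Hm : m ∈ x) by (destruct Em as [-> | ->]; auto; apply is_limit_succ; auto).
    destruct (C m Hm) as (z' & w' & Lm & Hzw & Hw' & (_ & HR)).
    assert (Oz' : is_ordinal z').
    { apply (ord_elem w'); auto; apply (ord_elem x); auto. }
    destruct (HR n Hno i Hi) as (q & Hq & K1 & K2).
    { apply (lt_le_trans (h i) m); auto; apply (lt_le_trans (h i) (succ (h i))); auto.
      apply lt_succ_diag. }
    exists q; splits; auto; [|eapply ord_trans; eauto].
    assert (Oq : is_ordinal q).
    { apply (ord_elem w'); auto; apply (ord_elem x); auto. }
    apply (le_lt_trans v z'); auto; eapply le_trans; eauto.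
Qed.

Lemma cf_eq_cfHOD_kappa : cf_eq_cfHOD kappa.
Proof. destruct some_positive as (n & Hn & H); apply (cf_eq_of_positive n Hn H). Qed.

End DefinableCofinalMaps.

Theorem theorem1p4 (V : estruct) (zfcV : ZFC V) (kappa : V)
  (kappa_singular : is_singular_cardinal kappa)
  (kappa_cf : has_uncountable_cf kappa)
  (cf_below : forall lambda : V,
      is_ordinal lambda -> lambda ∈ kappa -> cf_eq_cfHOD lambda) :
  cf_eq_cfHOD kappa.
Proof.
  destruct kappa_singular as [[Ck _] (delta & Hcf & Hdk)].
  destruct kappa_cf as (d & w & Hd & Hw & Hwd).
  apply is_omega_iff in Hw; subst w.
  apply (is_cf_unique _ _ _ Hcf) in Hd; subst d.
  apply (cf_eq_cfHOD_kappa kappa delta); assumption.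
Qed.
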